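(* Let $(G^\uparrow,G,H)$ be a correlated inhomogeneous graph system with planted matching $\pi^*$, true intersection graph $I$ and edge probabilities $(p_e)_{e\in E}$, and assume that $G^\uparrow$ is weakly inhomogeneous. Define $$x_{sparse}=\lim_{\varepsilon\to0}\operatorname*{pliminf}_{n\to+\infty}\frac{|V_{\leq(1-\varepsilon)}|}{n},\qquad V_{\leq(1-\varepsilon)}=\{v\in V:w_I(v)\leq1-\varepsilon\}.$$ Furthermore, assume that for some $r\geq0$, $$\min_{e\in E}p_e\geq\frac{1}{n(\log n)^r}\qquad\text{with high probability.}$$ Then, if $\hat\pi$ is an estimator of $\pi^*$, there exist at least $x_{sparse}(n-o_{\mathbb P}(n))$ vertices $v\in[n]$ such that $\hat\pi(v)\neq\pi^*(v)$.
   Context: **Graphs.** $n\to+\infty$, $V=[n]$, $E=\{\{u,v\}:u\neq v\in V\}$, $\mathcal S_n$ is the group of permutations of $[n]$. A graph over $V$ is identified with its edge set. For $\sigma\in\mathcal S_n$, $\sigma(\{u,v\})=\{\sigma(u),\sigma(v)\}$, $\sigma(K)=\{\sigma(e):e\in K\}$, $K\land_\sigma K'=\sigma(K)\cap K'$. **Balanced load.** Let $\vec E(K)$ be the set of directed edges $(u\to v)$ with $\{u,v\}\in K$. An allocation on $K$ is a map $\theta:\vec E(K)\to[0,1]$ with $\theta(u\to v)+\theta(v\to u)=1$ for all $(u\to v)\in\vec E(K)$; its load is $\partial\theta(v)=\sum_{u:\{u,v\}\in K}\theta(u\to v)$. It is balanced if for every edge $\{u,v\}$, $\partial\theta(u)<\partial\theta(v)$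 implies $\theta(u\to v)=0$. Balanced allocations exist and all have the same load function, denoted $w_K:V\to\mathbb R_+$. **Probabilistic notation.** $\operatorname{plimsup}_nX_n=\sup\{x\in\mathbb R:\limsup_n\mathbb P(X_n\geq x)>0\}$ and $\operatorname{pliminf}_nX_n=-\operatorname{plimsup}_n(-X_n)$. $X_n=o_{\mathbb P}(Y_n)$ means $X_n=c_nY_n$ with $c_n\to0$ in probability. ''With high probability'' means with probability tending to $1$ as $n\to+\infty$. **Inhomogeneous graphs.** Given a random vector $(p_e)_{e\in E}$ in $[0,1]^E$ (depending on $n$), an inhomogeneous random graph sampled from $(p_e)$ is a random graph such that, conditionally on $(p_e)$, the edge indicators are independent, edge $e$ being present with probability $p_e$. It is weakly inhomogeneous if, for $\mathbf e\in E$ uniformly random (independently), the sequence of random variables $(n\,p_{\mathbf e})_{n\geq1}$ is uniformly integrable. **Correlated inhomogeneous graph system.** Let $G^\uparrow$ be an inhomogeneous random graph with edge probabilities $(p_e)$ and let $s\in[0,1]$ (possibly depending on $n$). Let $K_1,K_2$ be obtained from $G^\uparrow$ by keeping each edge of $G^\uparrow$ with probability $s$, independently for each edge and for each of $K_1,K_2$. Let $\pi^*\in\mathcal S_n$ be uniformly random, independent of everything else, and set $G=(\pi^* )^{-1}(K_1)$, $H=K_2$. The true intersection graph is $I=G\land_{\pi^*}H$. An estimator of $\pi^*$ is an $\mathcal S_n$-valued function of the observation $(G,H)$. *)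

(* Defs.v *)
From HB Require Import structures.
From mathcomp Require Import all_boot all_order all_algebra all_fingroup.
From mathcomp Require Import all_classical all_reals all_analysis.

Set Implicit Arguments.
Unset Strict Implicit.
Unset Printing Implicit Defensive.

Import Order.TTheory GRing.Theory Num.Theory.
Import numFieldNormedType.Exports.

Local Open Scope classical_set_scope.
Local Open Scope ring_scope.

(* Graphs over the vertex set [n], encoded as 'I_n, are sets of edges. *)

Notation edge n := {e : {set 'I_n} | #|e| == 2%N}.
Notation graph n := {set edge n}.

Fact edge_act_proof n (sigma : 'S_n) (e : edge n) :
  #|[set sigma x | x in val e]%SET| == 2%N.
Proof. by rewrite (card_imset _ (@perm_inj _ sigma)); exact: (valP e). Qed.

Definition edge_act n (sigma : 'S_n) (e : edge n) : edge n :=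
  exist _ [set sigma x | x in val e]%SET (edge_act_proof sigma e).

Definition graph_act n (sigma : 'S_n) (K : graph n) : graph n :=
  [set edge_act sigma e | e in K]%SET.

Definition graph_meet n (sigma : 'S_n) (K K' : graph n) : graph n :=
  (graph_act sigma K :&: K')%SET.

Definition adj n (K : graph n) (u v : 'I_n) : bool :=
  [exists e in K, val e == [set u; v]%SET].

Section BalancedLoad.
Context {R : realType} {n : nat}.
Implicit Types (K : graph n) (theta : 'I_n -> 'I_n -> R).

(* [theta u v] is the mass put on the directed edge u -> v; its values outside
   the directed edges of K are irrelevant. *)
Definition allocation K theta : Prop :=
  forall u v, adj K u v -> 0 <= theta u v <= 1 /\ theta u v + theta v u = 1.

Definition load K theta (v : 'I_n) : R := \sum_(u | adj K u v) theta u v.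

Definition balanced K theta : Prop :=
  allocation K theta /\
  forall u v, adj K u v -> load K theta u < load K theta v -> theta u v = 0.

(* A balanced allocation always exists, and all of them have the same load, so
   neither the choice made by [xget] nor its default value matters. *)
Definition balanced_load K : 'I_n -> R :=
  load K (xget (fun _ _ => 0) [set theta | balanced K theta]).

End BalancedLoad.

Section ProbabilisticNotation.
Context {R : realType} {d : nat -> measure_display}.
Context {T : forall n, measurableType (d n)} (P : forall n, probability (T n) R).
Implicit Types X Y : forall n, T n -> R.

Definition plimsup X : \bar R :=
  ereal_sup [set x%:E | x in [set x : R |
    (0 < limn_esup (fun n => P n [set w | (x <= X n w)%R]))%E]].

Definition pliminf X : \bar R := (- plimsup (fun n w => - X n w)%R)%E.

Definition cvg_prob0 X : Prop :=
  forall eps : R, 0 < eps ->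
    P n [set w | eps <= `|X n w|] @[n --> \oo] --> 0%E.

Definition littleo_prob X Y : Prop :=
  exists c : forall n, {RV (P n) >-> R},
    (forall n w, X n w = c n w * Y n w) /\ cvg_prob0 (fun n => c n).

Definition whp (A : forall n, set (T n)) : Prop :=
  P n (A n) @[n --> \oo] --> 1%E.

End ProbabilisticNotation.

(* Probability that the random graph with independent edges, edge [e] being
   present with probability [q e], equals [g]. *)
Definition edge_law (R : realType) n (q : edge n -> R) (g : graph n) : R :=
  \prod_(e : edge n) (if e \in g then q e else 1 - q e).

Definition sigma_generated d (T : measurableType d) (R : realType) n
    (p : edge n -> T -> R) : set (set T) :=
  <<s [set A | exists e (B : set R), measurable B /\ A = p e @^-1` B] >>.

(* Data of a correlated inhomogeneous graph system on n vertices.  The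
   conditional law of Gup given the sigma-algebra of p is expressed by its
   defining integral identity; K1 and K2 are then conditionally independent
   thinnings of Gup, and pistar is uniform and independent of
   (p, Gup, K1, K2). *)
Record graph_system (R : realType) d (T : measurableType d)
    (P : probability T R) (n : nat) := GraphSystem {
  edge_prob : edge n -> {RV P >-> R};
  retention : R;
  Gup : T -> graph n;
  K1 : T -> graph n;
  K2 : T -> graph n;
  pistar : T -> 'S_n;
  edge_prob_itv : forall e w, 0 <= edge_prob e w <= 1;
  retention_itv : 0 <= retention <= 1;
  measurable_Gup : forall g, measurable (Gup @^-1` [set g]);
  measurable_K1 : forall k, measurable (K1 @^-1` [set k]);
  measurable_K2 : forall k, measurable (K2 @^-1` [set k]);
  measurable_pistar : forall sigma, measurable (pistar @^-1` [set sigma]);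
  Gup_law : forall A g, sigma_generated (fun e => edge_prob e : T -> R) A ->
    P (A `&` Gup @^-1` [set g]) =
    (\int[P]_(w in A) (edge_law (fun e => edge_prob e w) g)%:E)%E;
  thinning_law : forall A g k1 k2,
    sigma_generated (fun e => edge_prob e : T -> R) A ->
    let thin k := edge_law (fun e => retention * (e \in g)%:R) k in
    P (A `&` Gup @^-1` [set g] `&` K1 @^-1` [set k1] `&` K2 @^-1` [set k2]) =
    (P (A `&` Gup @^-1` [set g]) * (thin k1 * thin k2)%:E)%E;
  pistar_law : forall A g k1 k2 sigma,
    sigma_generated (fun e => edge_prob e : T -> R) A ->
    let B := A `&` Gup @^-1` [set g] `&` K1 @^-1` [set k1]
               `&` K2 @^-1` [set k2] in
    P (B `&` pistar @^-1` [set sigma]) = (P B * ((n`!)%:R^-1)%:E)%E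
}.

Section System.
Context {R : realType} {d : measure_display} {T : measurableType d}.
Context {P : probability T R} {n : nat}.
Variable S : graph_system P n.

Definition Gobs (w : T) : graph n := graph_act (pistar S w)^-1%g (K1 S w).

Definition Hobs (w : T) : graph n := K2 S w.

Definition true_meet (w : T) : graph n :=
  graph_meet (pistar S w) (Gobs w) (Hobs w).

End System.

Section Asymptotics.
Context {R : realType} {d : nat -> measure_display}.
Context {T : forall n, measurableType (d n)} {P : forall n, probability (T n) R}.
Variable S : forall n, graph_system (P n) n.

(* The expectation E[|X_n| 1(|X_n| >= M)] of X_n = n * p_e, where e is uniform
   over the edges and independent of p; the value is 0 when there is no edge. *)
Definition edge_tail (M : R) (n : nat) : \bar R :=
  ((#|{: edge n}|%:R^-1)%:E *
   \sum_(e : edge n) \int[P n]_(w in [set w |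
      (M <= `|n%:R * edge_prob (S n) e w|)%R])
     `|n%:R * edge_prob (S n) e w|%:E)%E.

Definition weakly_inhomogeneous : Prop :=
  ereal_sup [set edge_tail M n | n in [set n | (1 <= n)%N]] @[M --> +oo%R]
    --> 0%E.

Definition V_le n (x : R) (w : T n) : {set 'I_n} :=
  [set v | balanced_load (true_meet (S n) w) v <= x]%SET.

Definition x_sparse : \bar R :=
  lim (pliminf P (fun n w => #|V_le (1 - eps) w|%:R / n%:R)
         @[eps --> (0 : R)^'+]).

End Asymptotics.

(* Main.v *)
(* A vertex of load at most 1 - eps in the intersection graph I lies in a
   component of I with at most 1 / eps vertices: if S is the set of vertices of
   the component with load at most 1 - eps, then every edge meeting S gives all
   its mass to S, and a connected graph has at least |S| such edges, or |S| - 1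
   when S is the whole component.

   Small components have boundedly many isomorphism types, so almost every
   vertex u in a small component has linearly many vertices u' in other
   components of the same rooted type.  Let t exchange the components of u and
   u' along the isomorphism.  Replacing (K1, pistar) by (t K1, t pistar)
   leaves the observation (G, H) unchanged, preserves I, and divides the
   likelihood by at most a power of log n: only the boundedly many edges of K1
   at the two components move, they typically have p_e <= M / n by weak
   inhomogeneity, and p_f >= 1 / (n (log n)^r) for every f.  Since pihat does
   not see the exchange, it is right at u on at most a fraction polylog(n) / n
   of the total weight, and the expected number of correctly matched vertices
   in small components is o(n). *)
Require Import Defs.
From HB Require Import structures.
From mathcomp Require Import all_boot all_order all_algebra all_fingroup.
From mathcomp Require Import all_classical all_reals all_analysis.
From mathcomp Require Import measurable_realfun lra zify.
Import Order.TTheory GRing.Theory Num.Theory.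
Import numFieldNormedType.Exports.

Set Implicit Arguments.
Unset Strict Implicit.
Unset Printing Implicit Defensive.

Local Open Scope ring_scope.

Section FiniteCombinatorics.
Import mathcomp.boot.fintype mathcomp.boot.finset.

(** * Balanced load and component size *)

(** The exchange acts on configurations [((K1, K2), pistar)], and two obstacles shape its treatment.
    First, [t] maps [I] to itself, but [t K1] may meet [K2] in edges outside [I]: the components and
    types seen in the new configuration say nothing reliable about the exchange that produced it.
    Hence [t] is built from walks in [H], which the exchange leaves alone, and is determined by [u],
    [u'] and a set of walk codes; the number of such sets is bounded independently of n. Second, the
    edge probabilities are random. The comparison of likelihoods is made for fixed values of them
    and then integrated over cells of their sigma-algebra on which the graph [h] of heavy edges,
    those with [p_e >= M / n], is constant; a deterministic [h] then says which edges must not be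
    moved. Bounded degrees serve twice: in [K2] they keep the number of codes bounded, in [K1] they
    bound the number of moved edges and so the exponent of the logarithm. *)

Definition component n (K : graph n) (u : 'I_n) : {set 'I_n} :=
  [set v | connect (adj K) u v].

Lemma adj_sym n (K : graph n) : symmetric (adj K).
Proof. by move=> u v; rewrite /adj setUC. Qed.

Lemma adj_neq n (K : graph n) u v : adj K u v -> u != v.
Proof.
case/exists_inP=> e _ /eqP ve; have := valP e; rewrite /= ve cards2.
by case: (u != v).
Qed.

Section SmallLoad.
Context {R : realType} {n : nat}.
Variable K : graph n.

Lemma balanced_ge0 (theta : 'I_n -> 'I_n -> R) u v :
  allocation K theta -> adj K u v -> 0 <= theta u v.
Proof. by move=> /[apply] -[/andP[]]. Qed.

(* Growing [X] along edges from [rho], each new vertex of the sublevel set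
   collects a full unit of mass, since an edge leaving the sublevel set gives
   all its mass to the endpoint inside. *)
Lemma balanced_mass (theta : 'I_n -> 'I_n -> R) (c : R) (rho : 'I_n)
    (S : {set 'I_n}) :
  balanced K theta -> (forall v, (v \in S) = (load K theta v <= c)) ->
  #|(S :&: component K rho) :\ rho|%:R <=
    \sum_(v in S :&: component K rho) load K theta v.
Proof.
move=> [al bal] inS; set C := component K rho.
pose m (X : {set 'I_n}) := \sum_(v in S :&: X) \sum_(u in X | adj K u v) theta u v.
pose ok (X : {set 'I_n}) :=
  [&& rho \in X, X \subset C & #|(S :&: X) :\ rho|%:R <= m X].
have m_ge0 u v : adj K u v -> 0 <= theta u v by exact: balanced_ge0.
have ok0 : ok [set rho].
  apply/and3P; split; first by rewrite inE.
    by rewrite sub1set inE connect0.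
  have -> : (S :&: [set rho]) :\ rho = set0.
    by apply/setP=> x; rewrite !inE; case: eqP; rewrite ?andbF.
  rewrite cards0; apply: sumr_ge0 => v _; apply: sumr_ge0 => u /andP[_]; exact: m_ge0.
case: (arg_maxnP (fun X : {set 'I_n} => #|X|) ok0) => X /and3P[rX XC mX] maxX.
have clX x y : x \in X -> adj K x y -> y \in X.
  move=> xX xy; apply/negPn/negP=> yX.
  have nyr : y != rho by apply: contraNneq yX => ->.
  suff /maxX : ok (y |: X) by rewrite /= cardsU1 yX /= add1n ltnn.
  apply/and3P; split.
  - by rewrite !inE rX orbT.
  - rewrite subUset sub1set XC andbT inE.
    have := subsetP XC _ xX; rewrite inE => rx.
    by apply: connect_trans rx (connect1 xy).
  (* Of the new edges only the one between [x] and [y] is credited. For [y] in [S] it brings a full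
     unit: both directions count if [x] is in [S], and otherwise [y] has the smaller load and
     receives everything. *)
  have incl : m X + (y \in S)%:R <= m (y |: X).
    have -> : m (y |: X) = \sum_(v in S | v \in X) \sum_(u in y |: X | adj K u v)
      theta u v
       + \sum_(v in S | v == y) \sum_(u in y |: X | adj K u v) theta u v.
      rewrite /m (bigID (fun v => v == y)) /= addrC; congr (_ + _); apply: eq_bigl => v.
        rewrite !inE; case: (eqVneq v y) => [->|_]; last by rewrite andbT.
        by rewrite (negPf yX) !andbF.
      by rewrite !inE; case: eqP; rewrite ?andbF //= andbT.
    have e1 v : \sum_(u in y |: X | adj K u v) theta u v =
       \sum_(u in X | adj K u v) theta u v + (if adj K y v then theta y v else 0).
      rewrite (bigID (fun v => v == y)) /= addrC; congr (_ + _).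
        apply: eq_bigl => u; rewrite !inE; case: (eqVneq u y) => [->|_] /=.
          by rewrite (negPf yX) andbF.
        by rewrite andbT.
      case: ifP => yv; last first.
        by apply: big1 => i /andP[/andP[_ iv] /eqP iy]; move: iv; rewrite iy yv.
      rewrite (big_pred1 y) // => i; rewrite !inE.
      by case: (eqVneq i y) => [->|]; rewrite ?yv ?andbF ?andbT /= ?andbF.
    have e2 : m X + (x \in S)%:R * theta y x <=
      \sum_(v in S | v \in X) \sum_(u in y |: X | adj K u v) theta u v.
      under eq_bigr do rewrite e1.
      rewrite big_split /=; apply: lerD.
        rewrite /m le_eqVlt; apply/orP; left; apply/eqP; apply: eq_bigl => v.
        by rewrite inE.
      case xS: (x \in S); last first.
        rewrite mul0r; apply: sumr_ge0 => v _; case: ifP => // yv; exact: m_ge0.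
      rewrite mul1r (bigD1 x) /=; last by rewrite xS.
      rewrite adj_sym xy lerDl; apply: sumr_ge0 => v _; case: ifP => // yv;
        exact: m_ge0.
    have e3 : (y \in S)%:R * theta x y <=
      \sum_(v in S | v == y) \sum_(u in y |: X | adj K u v) theta u v.
      case yS: (y \in S); last first.
        rewrite mul0r; apply: sumr_ge0 => v _; apply: sumr_ge0 => u /andP[_];
          exact: m_ge0.
      rewrite mul1r (big_pred1 y); last by move=> i /=; case: (eqVneq i y) => [->|];
        rewrite ?yS ?andbF.
      rewrite (bigD1 x) /=; last by rewrite !inE xX orbT.
      by rewrite lerDl; apply: sumr_ge0 => u /andP[/andP[_ uy] _]; exact: m_ge0.
    apply: le_trans (lerD e2 e3).
    rewrite -addrA lerD2l.
    have [_ sum1] := al _ _ xy; have txy := m_ge0 _ _ xy.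
    have tyx : 0 <= theta y x by apply: m_ge0; rewrite adj_sym.
    case yS: (y \in S); last by rewrite mul0r addr0 mulr_ge0.
    case xS: (x \in S); first by rewrite !mul1r addrC sum1.
    have : load K theta y < load K theta x.
      move: yS xS; rewrite !inS => yc /negbT; rewrite -ltNge.
      exact: le_lt_trans.
    move/(bal y x); rewrite adj_sym => /(_ xy) y0.
    by rewrite mul0r mul1r add0r -sum1 y0 addr0.
  apply: le_trans incl; rewrite -lerBlDr.
  apply: le_trans mX; rewrite lerBlDr -natrD ler_nat.
  have -> : (S :&: (y |: X)) :\ rho = (if y \in S then [set y] else set0) :|:
    ((S :&: X) :\ rho).
    apply/setP=> z; case: ifP => yS; rewrite !inE.
      by case: (eqVneq z y) => [->|] //=; rewrite yS nyr.
    by case: (eqVneq z y) => [->|] //=; rewrite yS /= !andbF.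
  apply: leq_trans (leq_card_setU _ _) _; rewrite addnC leq_add2l.
  by case: ifP; rewrite ?cards1 ?cards0.
have XeqC : X = C.
  apply/eqP; rewrite eqEsubset XC /=; apply/subsetP=> v; rewrite inE => /connectP[p].
  elim: p rho rX {ok0 mX maxX XC C ok} => [|a p IH] rho' rX /=; first by move=> _ ->.
  by case/andP=> ra pa; apply: IH => //; exact: clX rX ra.
rewrite -XeqC; apply: le_trans mX _.
apply: ler_sum => v _; rewrite /load [leRHS](bigID (mem X)) /=.
rewrite (eq_bigl (fun u => adj K u v && (u \in X))); last by move=> u; rewrite andbC.
by rewrite lerDl; apply: sumr_ge0 => u /andP[uv _]; exact: m_ge0.
Qed.

Lemma balanced_small_component (theta : 'I_n -> 'I_n -> R) (eps : R) (v : 'I_n) :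
  0 < eps -> balanced K theta -> load K theta v <= 1 - eps ->
  #|component K v|%:R * eps <= 1.
Proof.
move=> e0 bal lv; have vC : v \in component K v by rewrite inE connect0.
pose S := [set v | load K theta v <= 1 - eps]%SET.
have inS w : (w \in S) = (load K theta w <= 1 - eps) by rewrite inE.
have symK : connect_sym (adj K) by apply: sym_connect_sym; exact: adj_sym.
have up rho : component K rho = component K v ->
    #|(S :&: component K v) :\ rho|%:R <= #|S :&: component K v|%:R * (1 - eps).
  move=> rv; have := balanced_mass rho bal inS; rewrite rv => /le_trans; apply.
  rewrite -sum1_card natr_sum mulr_suml; apply: ler_sum => u.
  by rewrite !inE mul1r => /andP[].
have [/subsetP CS|/subsetPn[rho rC rS]] := boolP (component K v \subset S).
  have {}up := up v erefl; have SC : S :&: component K v = component K v.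
    by apply/setIidPr/subsetP.
  move: up; rewrite SC (cardsD1 v (component K v)) vC natrD /=; nra.
(* A root outside the sublevel set loses no unit, so the nonempty set [S :&: component K v] would
   have at most [1 - eps] times its own cardinality. The component thus lies inside [S]. *)
have {up} := up rho; have -> : (S :&: component K v) :\ rho = S :&: component K v.
  apply/setP=> z; rewrite !inE; case: eqP => // ->; move: rS; rewrite inE.
  by move=> /negPf ->.
have -> : component K rho = component K v.
  apply/setP=> z; rewrite !inE; rewrite inE in rC; apply/esym.
  exact: (same_connect symK).
move=> /(_ erefl).
have : (0 < #|S :&: component K v|)%N by apply/card_gt0P; exists v;
  rewrite !inE lv connect0.
rewrite -(ltr_nat R); nra.
Qed.

End SmallLoad.

(** * Existence of balanced allocations, by minimizing an energy *)

Section Existence.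
Context {R : realType} {n : nat}.
Variable K : graph n.

Let energy (theta : 'I_n -> 'I_n -> R) := \sum_v load K theta v ^+ 2.

(** Imposed on all pairs of distinct vertices, so that the feasible set is a cube independent of
    [K]; values off the edges of [K] do not change the load. *)
Let total_allocation (theta : 'I_n -> 'I_n -> R) :=
  forall u v : 'I_n, u != v -> 0 <= theta u v <= 1 /\ theta u v + theta v u = 1.

Let load_ext (theta1 theta2 : 'I_n -> 'I_n -> R) :
  (forall u v : 'I_n, u != v -> theta1 u v = theta2 u v) ->
    load K theta1 =1 load K theta2.
Proof.
by move=> e v; apply: eq_bigr => u /adj_neq uv; apply: e.
Qed.

Let energy_min : exists theta, total_allocation theta /\
  forall theta', total_allocation theta' -> energy theta <= energy theta'.
Proof.
(* The coordinate of a pair [u < v] determines both directions, which builds in the constraint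
   [theta u v + theta v u = 1]. *)
pose th (x : 'rV[R]_(n * n)) (u v : 'I_n) : R :=
  if (u < v)%N then x ord0 (mxvec_index u v) else 1 - x ord0 (mxvec_index v u).
pose A := [set x : 'rV[R]_(n * n) | forall i, `[0 : R, 1]%classic (x ord0 i)]%classic.
have cA : compact A by apply: (@rV_compact R _ (fun=> `[0 : R, 1]%classic)) => i;
  exact: segment_compact.
have A0 : (A !=set0)%classic.
  by exists 0 => i /=; rewrite mxE in_itv /= lexx ler01.
have cE : {within A, continuous (fun x => energy (th x))}%classic.
  apply: continuous_subspaceT.
  have csum (V : topologicalType) (P : pred 'I_n) (F : 'I_n -> V -> R) :
      (forall i, continuous (F i)) -> continuous (fun x => \sum_(i | P i) F i x).
    move=> cF x; rewrite /continuous_at.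
    elim: (index_enum _) => [|i r IH].
      by rewrite big_nil; under eq_fun do rewrite big_nil; exact: cvg_cst.
    rewrite big_cons; under eq_fun do rewrite big_cons.
    by case: (P i) => //; apply: cvgD IH; exact: cF.
  have c1B (V : topologicalType) (f : V -> R) :
      continuous f -> continuous (fun x => 1 - f x).
    by move=> cf x; apply: cvgB; [exact: cvg_cst|exact: cf].
  have cload v : continuous (fun y : 'rV[R]_(n * n) => load K (th y) v).
    apply: (csum ('rV[R]_(n * n))%type _ (fun u y => th y u v)) => u x; rewrite /th;
      case: (u < v)%N; first exact: coord_continuous.
    exact: (c1B ('rV[R]_(n * n))%type _ (@coord_continuous _ _ _ _ _)).
  apply: (csum ('rV[R]_(n * n))%type _ (fun v y => load K (th y) v ^+ 2)) => v x.
  by apply: (@continuous_comp _ _ _ (fun y => load K (th y) v) (fun z => z ^+ 2));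
    [exact: cload|exact: exprn_continuous].
have [x xA xmin] := EVT_min_rV A0 cA cE.
exists (th x); split.
  move=> u v uv; have {}xA i : 0 <= x ord0 i <= 1.
    by move: xA; rewrite in_setE => /(_ i) /=; rewrite in_itv.
  have := xA (mxvec_index u v); have := xA (mxvec_index v u); rewrite /th.
  have : val u != val v by [].
  by case: ltngtP => //= _ _; lra.
move=> th' al'; have := xmin (mxvec (\matrix_(u, v) (if u == v then 0 else th' u v))).
have -> : energy (th (mxvec (\matrix_(u, v) (if u == v then 0 else th' u v)))) =
  energy th'.
  apply: eq_bigr => v _; congr (_ ^+ 2); apply: load_ext => a b ab.
  rewrite /th !mxvecE !mxE eq_sym [b == a]eq_sym (negPf ab).
  by case: ifP => // _; have [_ <-] := al' _ _ ab; rewrite addrK.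
apply; rewrite in_setE => i /=; rewrite in_itv /=.
case/mxvec_indexP: i => a b; rewrite mxvecE mxE; case: (eqVneq a b) => ab.
  by rewrite lexx ler01.
by have [] := al' _ _ ab.
Qed.

(** A minimizer of the sum of squared loads is balanced: mass on [u -> v] with [load u < load v]
    could be redirected to [u], lowering the sum. *)
Lemma balanced_exists : exists theta : 'I_n -> 'I_n -> R, balanced K theta.
Proof.
have [theta [al thmin]] := energy_min; exists theta; split.
  by move=> u v /adj_neq; apply: al.
move=> u v uv luv; apply/eqP/negPn/negP => tuv0.
have nuv := adj_neq uv.
have nvu : v != u by rewrite eq_sym.
have [/andP[t0 t1] t2] := al _ _ nuv; have [/andP[s0 s1] _] := al _ _ nvu.
have tuv : 0 < theta u v by rewrite lt0r tuv0.
pose dl := Num.min (theta u v) ((load K theta v - load K theta u) / 2).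
have dl0 : 0 < dl by rewrite lt_min tuv divr_gt0 // subr_gt0.
(* The bound [theta u v] keeps the new values in [[0, 1]]; the bound by half the gap makes the
   change of energy, [2 * dl * (load u - load v + dl)], negative. *)
have dl1 : dl <= theta u v by rewrite ge_min lexx.
have dl2 : dl <= (load K theta v - load K theta u) / 2 by rewrite ge_min lexx orbT.
pose th' a b := theta a b - dl * ((a == u) && (b == v))%:R
                          + dl * ((a == v) && (b == u))%:R.
have al' : total_allocation th'.
  move=> a b ab; have [ab01 sab] := al _ _ ab; rewrite /th'.
  case au : (a == u); last first.
    case av : (a == v); rewrite /= ?au ?av /= ?andbF ?andbT; last by lra.
    move/eqP: av => ?; subst a; rewrite [v == b]eq_sym in ab.
    case bu : (b == u) => /=; last by lra.
    by move/eqP: bu => ?; subst b; lra.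
  move/eqP: au => ?; subst a; rewrite (negPf nuv) /= ?andbF ?andbT.
  case bv : (b == v) => /=; last by lra.
  by move/eqP: bv => ?; subst b; lra.
have ld w : load K th' w = load K theta w - dl * (w == v)%:R + dl * (w == u)%:R.
  rewrite /load /th' !big_split /= sumrN -!mulr_sumr; congr (_ - dl * _ + dl * _).
    rewrite (eq_bigr (fun a => if a == u then (w == v)%:R else 0 : R)); last first.
      by move=> i _; case: (i == u).
    rewrite -big_mkcondr /=; case: (eqVneq w v) => [->|]; last by rewrite big1.
    by rewrite (big_pred1 u) // => i /=; case: (eqVneq i u) => [->|];
      rewrite ?uv ?andbF.
  rewrite (eq_bigr (fun a => if a == v then (w == u)%:R else 0 : R)); last first.
    by move=> i _; case: (i == v).
  rewrite -big_mkcondr /=; case: (eqVneq w u) => [->|]; last by rewrite big1.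
  by rewrite (big_pred1 v) // => i /=; case: (eqVneq i v) => [->|];
    rewrite ?andbF // adj_sym uv.
have := thmin _ al'; apply/negP; rewrite -ltNge.
have -> : energy th' = energy theta + (- (2 * dl * load K theta v) + dl ^+ 2)
                       + (2 * dl * load K theta u + dl ^+ 2).
  have pick x (f : 'I_n -> R) : f x = \sum_w f w * (w == x)%:R.
    rewrite (bigD1 x) //= eqxx mulr1 big1 ?addr0 // => i /negPf ->.
    by rewrite mulr0.
  rewrite [_ + dl ^+ 2 in RHS](pick u (fun w => 2 * dl * load K theta w + dl ^+ 2)).
  rewrite (pick v (fun w => - (2 * dl * load K theta w) + dl ^+ 2)).
  rewrite /energy -!big_split /=; apply: eq_bigr => w _; rewrite ld.
  case: (eqVneq w v) => [->|_] /=; first by rewrite (negPf nvu) /=; nra.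
  by case: eqP => _ /=; nra.
nra.
Qed.

Lemma balanced_loadP :
  exists2 theta : 'I_n -> 'I_n -> R, balanced K theta & balanced_load K = load K theta.
Proof.
have [th0 bal0] := balanced_exists.
exists (xget (fun _ _ => 0) [set theta | balanced K theta]%classic) => //.
exact: (@xgetPex _ _ [set theta | balanced K theta]%classic (ex_intro _ th0 bal0)).
Qed.

Lemma balanced_load_component (eps : R) v :
  0 < eps -> balanced_load K v <= 1 - eps -> #|component K v|%:R * eps <= 1.
Proof.
move=> e0; have [th bal ->] := balanced_loadP; exact: balanced_small_component.
Qed.

End Existence.

(** * Swapping two components of the intersection graph *)

Section EdgeAction.
Context {n : nat}.
Implicit Types (K : graph n) (e : edge n) (s t : 'S_n).

Lemma edgeP e : exists u v, u != v /\ val e = [set u; v].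
Proof. by have /cards2P[u [v [uv ->]]] := valP e; exists u, v. Qed.

Lemma adj_edge K e u v : val e = [set u; v] -> adj K u v = (e \in K).
Proof.
move=> ve; apply/exists_inP/idP => [[f fK /eqP]|eK]; last by exists e; rewrite ?ve.
by rewrite -ve => /val_inj <-.
Qed.

Lemma edge_actE s e u v : val e = [set u; v] -> val (edge_act s e) = [set s u; s v].
Proof. by rewrite /edge_act /= => ->; rewrite imsetU1 imset_set1. Qed.

Lemma edge_actM s t e : edge_act (s * t)%g e = edge_act t (edge_act s e).
Proof.
have [u [v [_ ve]]] := edgeP e; apply: val_inj.
by rewrite (edge_actE _ ve) (edge_actE _ (edge_actE s ve)) !permM.
Qed.

Lemma edge_act1 e : edge_act 1%g e = e.
Proof.
have [u [v [_ ve]]] := edgeP e; apply: val_inj.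
by rewrite (edge_actE _ ve) !perm1.
Qed.

Lemma edge_actK s : cancel (edge_act s) (edge_act s^-1%g).
Proof. by move=> e; rewrite -edge_actM mulgV edge_act1. Qed.

Lemma edge_act_inj s : injective (edge_act s).
Proof. exact: can_inj (edge_actK s). Qed.

Lemma mem_graph_act s K e : (edge_act s e \in graph_act s K) = (e \in K).
Proof. exact: (mem_imset K e (@edge_act_inj s)). Qed.

Lemma graph_actM s t K : graph_act (s * t)%g K = graph_act t (graph_act s K).
Proof.
by rewrite /graph_act -imset_comp; apply: eq_imset => e; rewrite edge_actM.
Qed.

Lemma graph_act1 K : graph_act 1%g K = K.
Proof.
by rewrite /graph_act (eq_imset _ edge_act1) imset_id.
Qed.

Lemma graph_actK s K : graph_act s^-1%g (graph_act s K) = K.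
Proof. by rewrite -graph_actM mulgV graph_act1. Qed.

Lemma sub_adj K K' u v : K \subset K' -> adj K u v -> adj K' u v.
Proof.
by move=> KK /exists_inP[e eK uv]; apply/exists_inP; exists e => //; apply: subsetP eK.
Qed.

Lemma graph_act_eq s K : (forall u v, adj K (s u) (s v) = adj K u v) ->
  graph_act s K = K.
Proof.
move=> sK; have sub : graph_act s K \subset K.
  apply/subsetP=> _ /imsetP[e eK ->]; have [u [v [_ ve]]] := edgeP e.
  by rewrite -(adj_edge K (edge_actE s ve)) sK (adj_edge K ve).
by apply/eqP; rewrite eqEcard sub (card_imset _ (@edge_act_inj s)) leqnn.
Qed.

End EdgeAction.

Section Component.
Context {n : nat}.
Variable K : graph n.

Lemma component_sym u v : (u \in component K v) = (v \in component K u).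
Proof. by rewrite !inE; apply: sym_connect_sym; exact: adj_sym. Qed.

Lemma component_refl u : u \in component K u.
Proof. by rewrite inE connect0. Qed.

Lemma component_eq u v : v \in component K u -> component K v = component K u.
Proof.
rewrite inE => uv; apply/setP=> z; rewrite !inE; apply/esym.
exact: (same_connect (sym_connect_sym (@adj_sym _ K)) uv).
Qed.

Lemma component_adj u x y : adj K x y -> (x \in component K u) = (y \in component K u).
Proof.
move=> xy; apply/idP/idP; rewrite !inE => /connect_trans; apply; apply: connect1 => //.
by rewrite adj_sym.
Qed.

End Component.

(** * Coding the vertices of a small component by walks *)

Section Walks.
Context {n : nat} (D k : nat).
Variable H : graph n.

Definition neighbors v : {set 'I_n} := [set w | adj H v w].

(* A list of [k] instructions "go to the [i]-th neighbour in [H]" or "stay"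
   ([None]); the number of codes does not depend on [n], and a code determines
   its endpoint from [H] and the starting vertex alone. *)
Definition walk_code := k.-tuple (option 'I_D).

Definition step (x : 'I_n) (o : option 'I_D) : 'I_n :=
  if o is Some i then nth x (enum (neighbors x)) i else x.

Definition walk (u : 'I_n) (c : walk_code) : 'I_n := foldl step u c.

Lemma walk_start : exists c : walk_code, forall u, walk u c = u.
Proof.
exists [tuple of nseq k None] => u; rewrite /walk /=.
by elim: k => [|m IH] //=.
Qed.

Lemma walk_path u p : path (adj H) u p -> {in u :: p, forall v, (#|neighbors v| <=
  D)%N} ->
  exists2 c : seq (option 'I_D), size c = size p & foldl step u c = last u p.
Proof.
elim: p u => [|v p IH] u /=; first by exists [::].
move=> /andP[uv vp] deg.
have degv : {in v :: p, forall w, (#|neighbors w| <= D)%N}.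
  by move=> w ws; apply: deg; rewrite inE ws orbT.
have [c sc lc] := IH v vp degv.
have iv : (index v (enum (neighbors u)) < #|neighbors u|)%N.
  by rewrite cardE index_mem mem_enum inE.
have iD := leq_trans iv (deg u (mem_head _ _)).
exists (Some (Ordinal iD) :: c); first by rewrite /= sc.
by rewrite /= nth_index // mem_enum inE.
Qed.

(** A path of [K] without repetition has fewer than [k] steps. It is also a path of [H], the degree
    bound makes each neighbour index an element of ['I_D], and [None] pads the code to length
    [k]. *)
Lemma walk_component (K : graph n) u v : K \subset H ->
  (#|component K u| <= k)%N ->
  {in component K u, forall w, (#|neighbors w| <= D)%N} ->
  v \in component K u -> exists c : walk_code, walk u c = v.
Proof.
move=> KH sC deg; rewrite inE => /connectP[p0 p0path ->].
case/shortenP: p0path => p pp up _ {p0}.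
have pC : {subset u :: p <= component K u}.
  move=> w; rewrite inE => /predU1P[->|wp]; first exact: component_refl.
  by rewrite inE; apply: (path_connect pp); rewrite inE wp orbT.
have sp : (size p < k)%N.
  apply: leq_trans sC; rewrite -[X in (X <= _)%N]/(size (u :: p)).
  by rewrite -(card_uniqP up); apply/subset_leq_card/subsetP.
have ppH : path (adj H) u p by apply: sub_path pp => a b; exact: sub_adj.
have [c sc lc] := walk_path ppH (fun w ws => deg w (pC w ws)).
have szc : size (c ++ nseq (k - size c) None) == k.
  by rewrite size_cat size_nseq subnKC // sc ltnW.
exists (Tuple szc); rewrite /walk /= foldl_cat lc.
by elim: (k - size c)%N => //=.
Qed.

End Walks.

Section Swap.
Context {n : nat} (D k : nat).
Variables (H : graph n).

(** The formula involves [H] but not [K], so the exchange can be rebuilt after [K1] has been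
    moved. *)
Definition swap_fun (u u' : 'I_n) (A : {set walk_code D k}) (x : 'I_n) : 'I_n :=
  if [pick c in A | walk H u c == x] is Some c then walk H u' c
  else if [pick c in A | walk H u' c == x] is Some c then walk H u c else x.

(** [insubd] yields a permutation for arbitrary arguments. Its default, the identity, is avoided as
    soon as [swap_fun] is injective, which [swap_funK] ensures for roots of equal type in distinct
    components. *)
Definition swap (u u' : 'I_n) (A : {set walk_code D k}) : 'S_n :=
  insubd (1%g : 'S_n) (finfun (swap_fun u u' A)).

Variable K : graph n.

Definition component_codes (u : 'I_n) : {set walk_code D k} :=
  [set c | walk H u c \in component K u].

Definition rooted_type :=
  ({set walk_code D k} * {set walk_code D k * walk_code D k} *
   {set walk_code D k * walk_code D k})%type.

(* Equality of [vertex_type] at [u] and [u'] makes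
   [walk H u c |-> walk H u' c] an isomorphism of rooted components. *)
Definition vertex_type (u : 'I_n) : rooted_type :=
  let A := component_codes u in
  (A,
   [set cc | [&& cc.1 \in A, cc.2 \in A & walk H u cc.1 == walk H u cc.2]],
   [set cc | [&& cc.1 \in A, cc.2 \in A & adj K (walk H u cc.1) (walk H u cc.2)]]).

Definition coded (u : 'I_n) :=
  forall v, v \in component K u -> exists c : walk_code D k, walk H u c = v.

Variables u u' : 'I_n.
Hypotheses (cu : coded u) (cu' : coded u').
Hypothesis (tu : vertex_type u = vertex_type u').
Hypothesis (uu' : u' \notin component K u).
Let A := component_codes u.
Let AE : component_codes u' = A.
Proof. by case: tu. Qed.

Let eq_walk c c' : c \in A -> c' \in A ->
  (walk H u c == walk H u c') = (walk H u' c == walk H u' c').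
Proof.
case: tu => Au kA _ cA c'A; move/setP/(_ (c, c')): kA.
by rewrite in_set [X in _ = X]in_set /= -Au -/A cA c'A.
Qed.

Let adj_walk c c' : c \in A -> c' \in A ->
  adj K (walk H u c) (walk H u c') = adj K (walk H u' c) (walk H u' c').
Proof.
case: tu => Au _ kA cA c'A; move/setP/(_ (c, c')): kA.
by rewrite in_set [X in _ = X]in_set /= -Au -/A cA c'A.
Qed.

Let walkC c : c \in A -> walk H u c \in component K u.
Proof. by rewrite [c \in _]inE. Qed.

Let walkC' c : c \in A -> walk H u' c \in component K u'.
Proof. by rewrite -AE [c \in _]inE. Qed.

Let disj x : x \in component K u -> x \notin component K u'.
Proof.
move=> xu; apply: contra uu' => xu'.
by rewrite -(component_eq xu) component_sym.
Qed.

Let swap_fun_walk c : c \in A -> swap_fun u u' A (walk H u c) = walk H u' c.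
Proof.
move=> cA; rewrite /swap_fun; case: pickP => [c' /andP[c'A]|/(_ c)].
  by rewrite eq_walk // => /eqP.
by rewrite cA eqxx.
Qed.

Let swap_fun_walk' c : c \in A -> swap_fun u u' A (walk H u' c) = walk H u c.
Proof.
move=> cA; rewrite /swap_fun; case: pickP => [c' /andP[c'A]|_].
  by move/eqP=> e; have := disj (walkC c'A); rewrite e walkC'.
case: pickP => [c' /andP[c'A]|/(_ c)]; first by rewrite -eq_walk // => /eqP.
by rewrite cA eqxx.
Qed.

Let swap_fun_out x : x \notin component K u -> x \notin component K u' ->
  swap_fun u u' A x = x.
Proof.
move=> xu xu'; rewrite /swap_fun; case: pickP => [c /andP[cA /eqP e]|_].
  by move: xu; rewrite -e walkC.
by case: pickP => [c /andP[cA /eqP e]|//]; move: xu'; rewrite -e walkC'.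
Qed.

Let codeP x : x \in component K u -> exists2 c, c \in A & x = walk H u c.
Proof. by move=> xu; have [c e] := cu xu; exists c; rewrite // inE e. Qed.

Let codeP' x : x \in component K u' -> exists2 c, c \in A & x = walk H u' c.
Proof. by move=> xu; have [c e] := cu' xu; exists c; rewrite // -AE inE e. Qed.

Let swap_funK : involutive (swap_fun u u' A).
Proof.
move=> x; have [/codeP[c cA ->]|xu] := boolP (x \in component K u).
  by rewrite swap_fun_walk // swap_fun_walk'.
have [/codeP'[c cA ->]|xu'] := boolP (x \in component K u').
  by rewrite swap_fun_walk' // swap_fun_walk.
by rewrite !swap_fun_out.
Qed.

Let swapE : swap u u' A =1 swap_fun u u' A.
Proof.
move=> x; rewrite /swap /insubd insubT /=.
  by apply/injectiveP => a b; rewrite !ffunE; apply: can_inj swap_funK _ _.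
by move=> p; rewrite -pvalE /= ffunE.
Qed.

Lemma swapK : involutive (swap u u' A).
Proof. by move=> x; rewrite !swapE swap_funK. Qed.

Lemma swap_root : swap u u' A u = u'.
Proof.
have [c cs] := walk_start D k H; rewrite swapE.
have cA : c \in A by rewrite inE cs component_refl.
by rewrite -{2}(cs u) swap_fun_walk // cs.
Qed.

Lemma swap_out x : x \notin component K u -> x \notin component K u' ->
  swap u u' A x = x.
Proof. by move=> xu xu'; rewrite swapE swap_fun_out. Qed.

Lemma swap_graph : graph_act (swap u u' A) K = K.
Proof.
apply: graph_act_eq.
suff adjS x y : adj K x y -> adj K (swap u u' A x) (swap u u' A y).
  by move=> x y; apply/idP/idP => [/adjS|]; [rewrite !swapK|exact: adjS].
move=> xy; have [xu|xu] := boolP (x \in component K u).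
  move: (xu); rewrite (component_adj _ xy) => yu.
  have [c cA xc] := codeP xu; have [c' c'A yc] := codeP yu.
  by rewrite !swapE xc yc !swap_fun_walk // -adj_walk // -xc -yc.
have [xu'|xu'] := boolP (x \in component K u').
  move: (xu'); rewrite (component_adj _ xy) => yu.
  have [c cA xc] := codeP' xu'; have [c' c'A yc] := codeP' yu.
  by rewrite !swapE xc yc !swap_fun_walk' // adj_walk // -xc -yc.
by rewrite !swap_out // -(component_adj _ xy).
Qed.

End Swap.

(** * Likelihood of a swap *)

Lemma leq_card_bigcup (I T : finType) (P : pred I) (F : I -> {set T}) :
  (#|\bigcup_(i | P i) F i| <= \sum_(i | P i) #|F i|)%N.
Proof.
elim/big_rec2: _ => [|i m B _ IH]; first by rewrite cards0.
by apply: leq_trans (leq_card_setU _ _) _; rewrite leq_add2l.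
Qed.

Lemma card_edge_le n : (#|{: edge n}| <= n * n)%N.
Proof.
rewrite card_sig -(_ : #|[set A : {set 'I_n} | #|A| == 2%N]| = #|_|); last first.
  by apply: eq_card => A; rewrite inE.
rewrite card_draws card_ord bin2.
apply: (@leq_trans (n * n.-1)); first by rewrite -divn2 leq_div.
by rewrite leq_mul2l leq_pred orbT.
Qed.

Section Incidence.
Context {n : nat}.
Implicit Types (K : graph n) (S : {set 'I_n}) (v : 'I_n).

Definition incident K S : graph n := [set e in K | ~~ [disjoint val e & S]].

Lemma mem_incident1 K v e : (e \in incident K [set v]) = (e \in K) && (v \in val e).
Proof. by rewrite inE disjoint_sym disjoints1 negbK. Qed.

Lemma card_neighbors K v : (#|neighbors K v| <= #|incident K [set v]|)%N.
Proof.
have sub : neighbors K v \subset \bigcup_(e in incident K [set v]) (val e :\ v).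
  apply/subsetP=> w; rewrite inE => vw; have wv : w != v by rewrite eq_sym (adj_neq vw).
  case/exists_inP: vw => e eK /eqP ve; apply/bigcupP; exists e.
    by rewrite mem_incident1 eK ve !inE eqxx.
  by rewrite ve !inE eqxx orbT wv.
apply: leq_trans (subset_leq_card sub) _.
apply: leq_trans (leq_card_bigcup _ _) _.
rewrite -sum1_card; apply: leq_sum => e; rewrite mem_incident1 => /andP[_ ve].
by have := cardsD1 v (val e); rewrite ve (eqP (valP e)) add1n => -[<-].
Qed.

Lemma card_incident K S : (#|incident K S| <= \sum_(v in S) #|incident K [set v]|)%N.
Proof.
have sub : incident K S \subset \bigcup_(v in S) incident K [set v].
  apply/subsetP=> e; rewrite inE => /andP[eK /pred0Pn[v /andP[/= ve vS]]].
  by apply/bigcupP; exists v; rewrite // mem_incident1 eK.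
exact: leq_trans (subset_leq_card sub) (leq_card_bigcup _ _).
Qed.

Lemma sum_incident K : (\sum_v #|incident K [set v]| = 2 * #|K|)%N.
Proof.
under eq_bigr => v _ do rewrite -sum1_card (eq_bigl _ _ (mem_incident1 K v)).
rewrite (exchange_big_dep (mem K)) /=; last by move=> v e _ /andP[].
rewrite (eq_bigr (fun=> 2%N)); first by rewrite sum_nat_const mulnC.
move=> e eK; under eq_bigl do rewrite eK; rewrite sum1_card.
exact/eqP/(valP e).
Qed.

Lemma card_high_degree K (D : nat) :
  (#|[set v | D < #|incident K [set v]|]| * D <= 2 * #|K|)%N.
Proof.
rewrite -sum_incident -sum_nat_const.
rewrite [leqRHS](bigID (mem [set v | D < #|incident K [set v]|]%N)) /=.
by apply: leq_trans (leq_addr _ _); apply: leq_sum => v; rewrite inE => /ltnW.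
Qed.

Lemma edge_act_fix (s : 'S_n) S (e : edge n) : (forall x, s x != x -> x \in S) ->
  [disjoint val e & S] -> edge_act s e = e.
Proof.
move=> sS dis; have [u [v [_ ve]]] := edgeP e; apply: val_inj.
rewrite (edge_actE s ve) ve; have fixed x : x \in val e -> s x = x.
  by move=> xe; apply/eqP/negPn/negP => /sS xS; move/pred0P/(_ x): dis;
    rewrite /= xe xS.
by rewrite !fixed // ve !inE eqxx ?orbT.
Qed.

End Incidence.

Section Odds.
Context {R : realType}.
Variables (s lam x y : R).
Hypotheses (s01 : 0 < s < 1) (x0 : 0 < x).

(** The right side, up to [lam], is the odds of an edge that is present in [k2]. It is reached by
    keeping only the term [x * (1 - s) * (1 - s)] of the denominator. *)
Lemma present_absent_odds : 1 <= lam -> x <= 1 ->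
  x * s * (1 - s) / (x * (1 - s) * (1 - s) + (1 - x)) <= lam * (s / (1 - s)).
Proof.
move=> lam1 x1; have /andP[s0 s1] := s01; have t0 : 0 < 1 - s by rewrite subr_gt0.
have xt : 0 < x * (1 - s) * (1 - s) by rewrite !mulr_gt0.
rewrite mulrA ler_pdivlMr // mulrAC ler_pdivrMr; last by lra.
rewrite -[leLHS]mul1r -[leRHS]mulrA ler_pM //; first by rewrite !mulr_ge0 // ltW.
have -> : x * s * (1 - s) * (1 - s) = s * (x * (1 - s) * (1 - s)) by lra.
by rewrite ler_pM2l //; lra.
Qed.

(** The denominator with [y] is at most 1, and [x <= 4^-1] makes the one with [x] at least 1/2; the
    factor 2 in the last hypothesis pays for this half. *)
Lemma absent_absent_odds : 0 < y -> y <= 1 -> x <= 4^-1 -> 2 * x <= lam * y ->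
  x * s * (1 - s) / (x * (1 - s) * (1 - s) + (1 - x)) <=
  lam * (y * s * (1 - s) / (y * (1 - s) * (1 - s) + (1 - y))).
Proof.
move=> y0 y1 x4 xy; have /andP[s0 s1] := s01; have t0 : 0 < 1 - s by rewrite subr_gt0.
have xt : 0 < x * (1 - s) * (1 - s) by rewrite !mulr_gt0.
have yt : 0 < y * (1 - s) * (1 - s) by rewrite !mulr_gt0.
have tt1 : y * (1 - s) * (1 - s) <= y.
  have t1 : 1 - s <= 1 by lra.
  by rewrite -mulrA ger_pMr // mulr_ile1 // ltW.
rewrite ler_pdivrMr; last by lra.
rewrite [lam * (_ / _)]mulrA [leRHS]mulrAC ler_pdivlMr; last by lra.
set a := _ + (1 - y); set b := _ + (1 - x).
have -> : x * s * (1 - s) * a = s * (1 - s) * (x * a) by lra.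
have -> : lam * (y * s * (1 - s)) * b = s * (1 - s) * (lam * y * b) by lra.
rewrite ler_pM2l ?mulr_gt0 //.
apply: (@le_trans _ _ (x * 1)); first by rewrite ler_pM2l // /a; lra.
apply: (@le_trans _ _ (lam * y * 2^-1)); first by lra.
have ly : 0 <= lam * y by apply: le_trans xy; rewrite mulr_ge0 // ltW.
by rewrite ler_wpM2l // /b; lra.
Qed.

End Odds.

Section PairLaw.
Context {R : realType} {n : nat}.
Variables (s : R) (p : edge n -> R).
Implicit Types k : graph n.

(** Joint law of the indicators of one edge in [K1] and [K2], the state of that edge in [Gup] being
    summed out. *)
Definition pair_weight e (b y : bool) : R :=
  p e * (if b then s else 1 - s) * (if y then s else 1 - s)
  + (1 - p e) * (~~ b)%:R * (~~ y)%:R.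

Definition pair_law k1 k2 : R := \prod_e pair_weight e (e \in k1) (e \in k2).

Lemma pair_lawE k1 k2 :
  \sum_g edge_law p g * (edge_law (fun e => s * (e \in g)%:R) k1 *
                         edge_law (fun e => s * (e \in g)%:R) k2) = pair_law k1 k2.
Proof.
rewrite /pair_law.
under [RHS]eq_bigr do rewrite /pair_weight.
rewrite bigA_distr; apply: eq_bigr => g _.
rewrite /edge_law -!big_split /=; apply: eq_bigr => e _.
by case: (e \in g); case: (e \in k1); case: (e \in k2);
  rewrite /= ?mulr1 ?mulr0 ?subr0 ?mulrA ?mulr1 ?mul0r ?mulr0.
Qed.

Hypotheses (s01 : 0 <= s <= 1) (p01 : forall e, 0 <= p e <= 1).

Lemma pair_weight_ge0 e b y : 0 <= pair_weight e b y.
Proof.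
have /andP[pe0 pe1] := p01 e; have /andP[s0 s1] := s01; rewrite /pair_weight.
by apply: addr_ge0; rewrite !mulr_ge0 ?subr_ge0 //; [case: b|case: y];
  rewrite ?subr_ge0.
Qed.

Lemma pair_law_ge0 k1 k2 : 0 <= pair_law k1 k2.
Proof. by apply: prodr_ge0 => e _; exact: pair_weight_ge0. Qed.

(* The likelihood is proportional to the product over [e] in [k1] of the odds
   [pair_weight e true y / pair_weight e false y], [y := (e \in k2)].  For
   [y = true] they equal [s / (1 - s)], whatever [e], and dominate those for
   [y = false]. *)
Lemma pair_law_swap (k1 k2 : graph n) (t : 'S_n) (S : {set 'I_n}) (lam : R) :
  (forall e, 0 < p e) -> 1 <= lam ->
  graph_act t (k1 :&: k2) = k1 :&: k2 ->
  (forall x, t x != x -> x \in S) ->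
  {in incident k1 S, forall e, p e <= 4^-1 /\ forall f, 2 * p e <= lam * p f} ->
  pair_law k1 k2 <= lam ^+ #|incident k1 S| * pair_law (graph_act t k1) k2.
Proof.
move=> p0 lam1 tI tS light.
have lam0 : 0 <= lam by lra.
(* For [s] equal to 0 or 1 the odds degenerate. But then an edge of [k1] outside [k2] has weight
   zero, so a positive likelihood forces [k1] to be the intersection, which [t] fixes. *)
have [s0|s0] := eqVneq (s * (1 - s)) 0.
  have [->|nz] := eqVneq (pair_law k1 k2) 0.
    by rewrite mulr_ge0 ?exprn_ge0 ?pair_law_ge0.
  have k12 : k1 \subset k2.
    apply/subsetP => e ek1; apply/negPn/negP => ek2; move/eqP: nz; apply.
    rewrite /pair_law (bigD1 e) //= /pair_weight ek1 (negPf ek2) /=.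
    by rewrite mulr0 mul0r addr0 -mulrA s0 mulr0 mul0r.
  move: tI; rewrite (setIidPl k12) => ->.
  by rewrite ler_peMl ?pair_law_ge0 // exprn_ege1.
have s1 : 0 < s < 1.
  by move: s01 s0; rewrite mulf_eq0 subr_eq0 negb_or !lt_neqAle [1 == s]eq_sym [0 ==
    s]eq_sym => /andP[-> ->] /andP[-> ->].
have a0 e y : 0 < pair_weight e false y.
  by have := p0 e; have := p01 e; rewrite /pair_weight; case: y => /=; nra.
pose rho e y := pair_weight e true y / pair_weight e false y.
have rho_ge0 e y : 0 <= rho e y by rewrite divr_ge0 ?pair_weight_ge0.
have split k : pair_law k k2 =
    \prod_e pair_weight e false (e \in k2) * \prod_(e in k) rho e (e \in k2).
  rewrite [X in _ * X]big_mkcond -big_split /=; apply: eq_bigr => e _.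
  by case: (e \in k); rewrite ?mulr1 // /rho mulrCA divff ?mulr1 // gt_eqF.
rewrite !split mulrCA ler_wpM2l //.
  by apply: prodr_ge0 => e _; exact: pair_weight_ge0.
rewrite big_imset /=; last by move=> e f _ _; exact: edge_act_inj.
have -> : lam ^+ #|incident k1 S| =
  \prod_(e in k1) (if ~~ [disjoint val e & S] then lam else 1).
  rewrite -big_mkcondr /= -prodr_const; apply: eq_bigl => e.
  by rewrite inE.
rewrite -big_split /=; apply: ler_prod => e ek1; rewrite rho_ge0 /=.
case: ifPn => [eS|]; last first.
  by rewrite negbK => dis; rewrite (edge_act_fix tS dis) mul1r.
have [pe plam] : p e <= 4^-1 /\ forall f, 2 * p e <= lam * p f.
  by apply: light; rewrite inE ek1.
set f := edge_act t e.
have rho1 g : rho g true = s / (1 - s).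
  rewrite /rho /pair_weight /= mulr0 addr0 mulr0 addr0.
  have pg := p0 g; have /andP[s00 s11] := s1; have s10 : 0 < 1 - s by lra.
  by rewrite -mulf_div [s / s]divff ?gt_eqF // mulr1 -mulf_div divff ?gt_eqF // mul1r.
(* An edge of the intersection is sent to an edge of the intersection, and both odds are
   [s / (1 - s)]. *)
have [ek2|ek2] := boolP (e \in k2).
  have fk2 : f \in k2.
    have : f \in graph_act t (k1 :&: k2) by rewrite mem_graph_act inE ek1.
    by rewrite tI inE => /andP[].
  have /andP[s00 s11] := s1.
  by rewrite fk2 !rho1 ler_peMl // divr_ge0 ?subr_ge0 // ltW.
(* Here the image hits an edge of [k2] outside the intersection: the intersection grows, and the
   odds do not decrease. *)
have [fk2|fk2] := boolP (f \in k2).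
  rewrite rho1 /rho /pair_weight /= !(mulr0, addr0, mulr1).
  by apply: present_absent_odds; rewrite ?p0 //; case/andP: (p01 e).
rewrite /rho /pair_weight /= !(mulr0, addr0, mulr1).
by apply: absent_absent_odds; rewrite ?p0 //; case/andP: (p01 f).
Qed.

End PairLaw.

(** * Counting correctly matched vertices *)

(* [((K1, K2), pistar)] *)
Definition config n := (graph n * graph n * 'S_n)%type.

Lemma small_hits_arith (N hp sp b e1 e2 e3 u1 u2 t D k m : nat) :
  (N <= hp + sp -> sp <= k * b + t * (m + k) -> b * D <= 2 * e1 + 2 * e2 + 2 * D * e3 ->
   e1 <= u1 -> e2 <= u1 -> D * e3 <= D * u2 ->
   N * D * m <= D * (hp * m) + m * (k * (4 * u1 + 2 * D * u2) + D * (t * (m + k))))%N.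
Proof.
move=> c1 c2 c3 c4 c5 c6.
have c7 : (m * (k * (b * D)) <= m * (k * (4 * u1 + 2 * D * u2)))%N.
  by rewrite !leq_mul2l; apply/orP; right; apply/orP; right; lia.
apply: (@leq_trans ((hp + (k * b + t * (m + k))) * D * m)); last by lia.
by rewrite !leq_mul2r; apply/orP; right; apply/orP; right; lia.
Qed.

Section Exchange.
Context {R : realType} {n : nat}.
Variables (D k : nat) (h : graph n) (pihat : graph n -> graph n -> 'S_n).

Implicit Types (x : config n) (u v : 'I_n).

Definition meet x : graph n := x.1.1 :&: x.1.2.

(** Few edges of [x.1.2] at a vertex make walks codable, few edges of [x.1.1] bound the number of
    moved edges, and the absence of edges of [h] bounds the cost of moving each. *)
Definition bad x : {set 'I_n} :=
  [set v | [|| D < #|incident x.1.1 [set v]|, D < #|incident x.1.2 [set v]|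
             | 0 < #|incident (x.1.1 :&: h) [set v]|]%N].

Definition small x : {set 'I_n} := [set u | #|component (meet x) u| <= k]%N.

Definition good x : {set 'I_n} :=
  [set u in small x | [disjoint component (meet x) u & bad x]].

Definition vtype x u := @vertex_type n D k x.1.2 (meet x) u.

Definition vtype_class x t : {set 'I_n} := [set v in good x | vtype x v == t].

(** The summand [k] pays for the vertices of the component of [u] itself, which cannot be exchanged
    with [u]; at least [m] partners remain. *)
Definition popular (m : nat) x : {set 'I_n} :=
  [set u in good x | m + k <= #|vtype_class x (vtype x u)|]%N.

(* Correctly matched vertices, labelled by their image [u = pistar v] in [H]. *)
Definition hits x : {set 'I_n} :=
  [set u | (pihat (graph_act x.2^-1%g x.1.1) x.1.2)^-1%g u == x.2^-1%g u].

Definition relocate (t : 'S_n) x : config n :=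
  ((graph_act t x.1.1, x.1.2), (x.2 * t)%g).

Let codes x u := @component_codes n D k x.1.2 (meet x) u.

Let shift (u u' : 'I_n) (A : {set walk_code D k}) x := relocate (swap x.1.2 u u' A) x.

Let partners x u := vtype_class x (vtype x u) :\: component (meet x) u.

Lemma relocate_inj t : injective (relocate t).
Proof.
move=> [[a b] s] [[a' b'] s'] [ea -> es]; congr (_, _, _); last exact: mulIg es.
by rewrite -(graph_actK t a) ea graph_actK.
Qed.

Lemma relocate_obs t x :
  graph_act (relocate t x).2^-1%g (relocate t x).1.1 = graph_act x.2^-1%g x.1.1.
Proof. by rewrite /relocate /= invMg graph_actM graph_actK. Qed.

Let good_coded x u : u \in good x -> @coded n D k x.1.2 (meet x) u.
Proof.
rewrite !inE => /andP[sm dis] v; apply: walk_component => //; first exact: subsetIr.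
move=> w wC; apply: leq_trans (card_neighbors _ _) _.
move/pred0P/(_ w): dis; rewrite /= wC /= inE => /negbT.
by rewrite !negb_or -!leqNgt => /and3P[].
Qed.

Let good_incident x u : u \in good x ->
  (\sum_(v in component (meet x) u) #|incident x.1.1 [set v]| <= k * D)%N.
Proof.
rewrite !inE => /andP[sm dis].
apply: leq_trans (_ : #|component (meet x) u| * D <= _)%N;
  last by rewrite leq_mul2r sm orbT.
rewrite -sum_nat_const; apply: leq_sum => v vC.
move/pred0P/(_ v): dis; rewrite /= vC /= inE => /negbT.
by rewrite !negb_or -!leqNgt => /and3P[].
Qed.

Let good_light x u v e : u \in good x -> v \in component (meet x) u ->
  e \in x.1.1 -> v \in val e -> e \notin h.
Proof.
rewrite [u \in _]inE => /andP[sm dis] vC ek ve; apply/negP => eh.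
move/pred0P/(_ v): dis; rewrite /= vC /= inE => /negbT.
rewrite !negb_or -!leqNgt leqn0 => /and3P[_ _ /eqP/cards0_eq/setP/(_ e)].
by rewrite mem_incident1 !inE ek eh ve.
Qed.

Lemma card_bad x :
  (#|bad x| * D <= 2 * #|x.1.1| + 2 * #|x.1.2| + 2 * D * #|x.1.1 :&: h|)%N.
Proof.
pose B1 := [set v | D < #|incident x.1.1 [set v]|]%N.
pose B2 := [set v | D < #|incident x.1.2 [set v]|]%N.
pose B3 := [set v | 0 < #|incident (x.1.1 :&: h) [set v]|]%N.
have -> : bad x = B1 :|: B2 :|: B3 by apply/setP=> v; rewrite !inE orbA.
have B3h : (#|B3| <= 2 * #|x.1.1 :&: h|)%N.
  rewrite -sum_incident -sum1_card big_mkcond; apply: leq_sum => v _.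
  by rewrite inE; case: (#|_|).
have c12 := leq_of_leqif (leq_card_setU (B1 :|: B2) B3).
have c1 := leq_of_leqif (leq_card_setU B1 B2).
have h1 : (#|B1| * D <= 2 * #|x.1.1|)%N := card_high_degree x.1.1 D.
have h2 : (#|B2| * D <= 2 * #|x.1.2|)%N := card_high_degree x.1.2 D.
nia.
Qed.

(** Either the component contains a bad vertex, and a bad vertex spoils at most the [k] vertices of
    its own small component, or the type is rare, and the number of types does not depend on [n]. *)
Lemma card_small_unpopular m x :
  (#|small x :\: popular m x| <=
   k * #|bad x| + #|{: rooted_type D k}| * (m + k))%N.
Proof.
pose U1 := \bigcup_(v in bad x | v \in small x) component (meet x) v.
pose U2 := \bigcup_(t | (#|vtype_class x t| <= m + k)%N) vtype_class x t.
have sub : small x :\: popular m x \subset U1 :|: U2.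
  apply/subsetP=> u; rewrite !inE => /andP[npop sm].
  move: npop; rewrite sm /=.
  have [dis|/pred0Pn[v /andP[/= vC vb]] _] := boolP [disjoint _ & _]; last first.
    apply/orP; left; apply/bigcupP; exists v; last by rewrite component_sym.
    by rewrite vb inE (component_eq vC).
  rewrite /= -ltnNge => /ltnW cl; apply/orP; right; apply/bigcupP.
  by exists (vtype x u); rewrite // !inE sm dis eqxx.
apply: leq_trans (subset_leq_card sub) _; apply: leq_trans (leq_card_setU _ _) _.
apply: leq_add; apply: leq_trans (leq_card_bigcup _ _) _.
  rewrite mulnC -sum_nat_const big_mkcondr /=; apply: leq_sum => v _.
  by case: ifP => //; rewrite inE.
rewrite -sum_nat_const big_mkcond /=; apply: leq_sum => t _.
by case: ifP.
Qed.

Lemma card_hits_small m x :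
  (#|hits x :&: small x| * D * m <= D * (#|hits x :&: popular m x| * m) +
    m * (k * (4 * #|x.1.1 :|: x.1.2| + 2 * D * #|(x.1.1 :|: x.1.2) :&: h|) +
         D * (#|{: rooted_type D k}| * (m + k))))%N.
Proof.
have c1 : (#|hits x :&: small x| <=
  #|hits x :&: popular m x| + #|small x :\: popular m x|)%N.
  apply: leq_trans (leq_card_setU _ _); apply/subset_leq_card/subsetP => u.
  rewrite inE => /andP[uh us]; rewrite !in_setU in_setI in_setD uh us andbT.
  by case: (u \in popular m x).
have c4 : (#|x.1.1| <= #|x.1.1 :|: x.1.2|)%N by apply/subset_leq_card/subsetUl.
have c5 : (#|x.1.2| <= #|x.1.1 :|: x.1.2|)%N by apply/subset_leq_card/subsetUr.
have c6 : (D * #|x.1.1 :&: h| <= D * #|(x.1.1 :|: x.1.2) :&: h|)%N.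
  by rewrite leq_mul2l subset_leq_card ?orbT // setSI // subsetUl.
exact: small_hits_arith c1 (card_small_unpopular m x) (card_bad x) c4 c5 c6.
Qed.

Variables (mu : config n -> R) (lam : R).
Hypothesis mu_ge0 : forall x, 0 <= mu x.
Hypothesis lam1 : 1 <= lam.
Hypothesis mu_relocate : forall x (t : 'S_n) (S : {set 'I_n}),
  graph_act t (meet x) = meet x -> (forall v, t v != v -> v \in S) ->
  {in incident x.1.1 S, forall e, e \notin h} ->
  mu x <= lam ^+ #|incident x.1.1 S| * mu (relocate t x).

(** The exponent counts edges of [x.1.1] at two components, each with at most [k] vertices of degree
    at most [D]. *)
Let mu_shift x u u' : u \in good x -> u' \in partners x u ->
  mu x <= lam ^+ (2 * k * D) * mu (shift u u' (codes x u) x).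
Proof.
move=> ug; rewrite inE => /andP[u'C]; rewrite inE => /andP[u'g /eqP/esym tu].
have cu := good_coded ug; have cu' := good_coded u'g.
set t := swap x.1.2 u u' (codes x u).
pose S := component (meet x) u :|: component (meet x) u'.
have tI : graph_act t (meet x) = meet x by exact: swap_graph.
have tS v : t v != v -> v \in S.
  apply: contraNT; rewrite inE negb_or => /andP[vu vu']; apply/eqP.
  exact: swap_out.
have dS : {in incident x.1.1 S, forall e, e \notin h}.
  move=> e; rewrite inE => /andP[ek /pred0Pn[v /andP[/= ve]]].
  by rewrite inE => /orP[vC|vC];
    [exact: good_light ug vC ek ve|exact: good_light u'g vC ek ve].
apply: le_trans (mu_relocate tI tS dS) _.
rewrite ler_wpM2r // ler_weXn2l //.
apply: leq_trans (card_incident _ _) _.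
apply: leq_trans (_ : \sum_(v in component (meet x) u) #|incident x.1.1 [set v]| +
  \sum_(v in component (meet x) u') #|incident x.1.1 [set v]| <= _)%N.
  rewrite big_mkcond [X in (_ <= X + _)%N]big_mkcond [X in (_ <= _ + X)%N]big_mkcond.
  rewrite -big_split /=; apply: leq_sum => v _; rewrite inE.
  by case: (v \in _); case: (v \in _); rewrite ?leq_addr ?leq_addl.
by rewrite -mulnA mul2n -addnn leq_add // good_incident.
Qed.

(* The exchange can be undone knowing only [u] and [A]: it does not change the
   estimator, which is right at [u], so [u'] is where the new matching sends
   [pihat^-1 u]. *)
Let shift_inj u A : {in [pred y : config n * 'I_n |
    [&& codes y.1 u == A, u \in hits y.1, u \in good y.1 & y.2 \in partners y.1 u]] &,
  injective (fun y => shift u y.2 A y.1)}.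
Proof.
pose F (z : config n) := z.2 ((pihat (graph_act z.2^-1%g z.1.1) z.1.2)^-1%g u).
have image y : [&& codes y.1 u == A, u \in hits y.1,
  u \in good y.1 & y.2 \in partners y.1 u] ->
    F (shift u y.2 A y.1) = y.2.
  case: y => x u' /= /and4P[/eqP <-]; rewrite inE => /eqP hx ug;
    rewrite inE => /andP[u'C].
  rewrite inE => /andP[u'g /eqP/esym tu].
  rewrite /F relocate_obs /= hx permM permKV.
  by apply: swap_root => //; exact: good_coded.
move=> [x u'] [y u''] px py exy.
have := image _ px; rewrite [shift _ _ _ _]exy (image _ py) /= => uu'; subst u''.
move: exy => /= exy.
have eH : x.1.2 = y.1.2 by case: exy.
by move: exy; rewrite /shift eH => /relocate_inj ->.
Qed.

(** Double counting: a popular hit [u] of [x] charges [mu x] to each of at least [m] exchanged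
    configurations. For fixed [u] and code set [A] the exchanged configurations are distinct, so
    they weigh at most the total mass; it remains to count the pairs [(u, A)]. *)
Lemma expected_popular_hits m :
  \sum_x mu x * (#|hits x :&: popular m x| * m)%:R <=
  lam ^+ (2 * k * D) * (n * #|{set walk_code D k}|)%:R * \sum_x mu x.
Proof.
have lam0 : 0 <= lam by exact: le_trans lam1.
pose cond u A (y : config n * 'I_n) :=
  [&& codes y.1 u == A, u \in hits y.1, u \in good y.1 & y.2 \in partners y.1 u].
apply: (@le_trans _ _ (lam ^+ (2 * k * D) *
    \sum_u \sum_A \sum_(y | cond u A y) mu (shift u y.2 A y.1))); last first.
  rewrite -mulrA ler_wpM2l ?exprn_ge0 //.
  apply: (@le_trans _ _ (\sum_(u : 'I_n) \sum_(A : {set walk_code D k}) \sum_x mu x)).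
    apply: ler_sum => u _; apply: ler_sum => A _.
    rewrite -(big_imset mu (@shift_inj u A)) /=.
    rewrite [leRHS](bigID (mem [set shift u y.2 A y.1 | y in cond u A])) /=.
    by rewrite lerDl sumr_ge0.
  by rewrite !sumr_const card_ord -mulrnA mulr_natl mulnC.
rewrite mulr_sumr.
apply: (@le_trans _ _ (\sum_x \sum_(u in hits x :&: popular m x)
    \sum_(u' in partners x u) lam ^+ (2 * k * D) * mu (shift u u' (codes x u) x))).
  apply: ler_sum => x _; rewrite natrM mulrA -mulrA mulrCA -[_%:R]/(#|_|%:R).
  rewrite mulr_natl -sumr_const; apply: ler_sum => u;
    rewrite !inE => /andP[_ /andP[ug pop]].
  have {}ug : u \in good x by rewrite !inE.
  apply: (@le_trans _ _ (\sum_(u' in partners x u) mu x)).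
    rewrite sumr_const -[leRHS]mulr_natr ler_wpM2l // ler_nat.
    rewrite cardsD; have : (#|vtype_class x (vtype x u) :&: component (meet x) u| <=
      k)%N.
      apply: leq_trans (subset_leq_card (subsetIr _ _)) _.
      by move: ug; rewrite !inE => /andP[].
    lia.
  by apply: ler_sum => u' pu'; exact: mu_shift.
have regroup u : \sum_A \sum_(y | cond u A y) mu (shift u y.2 A y.1) =
    \sum_x \sum_u' if [&& u \in hits x, u \in good x & u' \in partners x u]
      then mu (shift u u' (codes x u) x) else 0.
  rewrite pair_big /=; under eq_bigr do rewrite big_mkcond.
  rewrite exchange_big; apply: eq_bigr => -[x u'] _ /=; rewrite -big_mkcond /cond /=.
  case: ifP => _; last by rewrite big_pred0 // => A; rewrite andbF.
  by rewrite (big_pred1 (codes x u)) // => A /=; rewrite andbT eq_sym.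
under [leRHS]eq_bigr do rewrite regroup mulr_sumr.
rewrite exchange_big; apply: ler_sum => x _.
rewrite [leLHS]big_mkcond; apply: ler_sum => u _ /=; case: ifP => [|_]; last first.
  by rewrite mulr_ge0 ?exprn_ge0 // sumr_ge0 // => u' _; case: ifP.
rewrite inE [u \in popular _ _]inE => /andP[uh /andP[ug _]].
rewrite mulr_sumr big_mkcond; apply: ler_sum => u' _.
rewrite uh ug /=.
by case: ifP; rewrite ?mulr0.
Qed.

End Exchange.

End FiniteCombinatorics.

Local Open Scope classical_set_scope.
Local Open Scope ring_scope.

(** * Laws in a correlated graph system *)

Section FiniteValued.
Context d (T : measurableType d) (R : realType) (P : probability T R).
Context (F : finType) (Z : T -> F).
Hypothesis mZ : forall z, measurable (Z @^-1` [set z]).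

Lemma measurable_finite (Q : pred F) : measurable [set w | Q (Z w)].
Proof.
have -> : [set w | Q (Z w)] = \bigcup_(z in [set z | Q z]) (Z @^-1` [set z]).
  by apply/seteqP; split => w /=; [exists (Z w)|case=> z /= Qz ->].
by apply: fin_bigcup_measurable => // z _.
Qed.

Lemma measure_finite (B : set T) (Q : pred F) : measurable B ->
  (\sum_(z | Q z) P (B `&` Z @^-1` [set z]) = P (B `&` [set w | Q (Z w)]))%E.
Proof.
move=> mB; have seqE (s : seq F) : uniq s ->
    (\sum_(z <- s) P (B `&` Z @^-1` [set z]) = P (B `&` [set w | Z w \in s]))%E.
  elim: s => [_|z s IH /= /andP[zs us]].
    rewrite big_nil; have -> : B `&` [set w | Z w \in [::]] = set0.
      by apply/seteqP; split => w //= [].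
    by rewrite measure0.
  rewrite big_cons IH // -measureU.
  - congr (P _); apply/seteqP; split => w /=; rewrite inE.
      by case=> -[Bw] => [->|->]; rewrite ?eqxx ?orbT.
    by case=> Bw /predU1P[]; [left|right].
  - by apply: measurableI => //; exact: mZ.
  - by apply: measurableI => //; exact: (measurable_finite (fun z => z \in s)).
  - apply/seteqP; split => w //= [[_ Zz] [_]]; rewrite Zz => zs'.
    by rewrite zs' in zs.
rewrite -big_filter seqE ?filter_uniq ?index_enum_uniq //.
congr (P (_ `&` _)); apply/seteqP; split => w /=;
  rewrite mem_filter mem_index_enum andbT.
  by move=> Qw.
by move=> Qw.
Qed.

End FiniteValued.

Section SigmaGenerated.
Context d (T : measurableType d) (R : realType) (n : nat).
Variable p : edge n -> T -> R.
Hypothesis mp : forall e, measurable_fun setT (p e).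

Let gen := [set A | exists e (B : set R), measurable B /\ A = p e @^-1` B].

Lemma sigma_generated_measurable A : sigma_generated p A -> measurable A.
Proof.
apply: smallest_sub; first exact: sigma_algebra_measurable.
move=> _ [e [B [mB ->]]]; rewrite -[X in measurable X]setTI; exact: mp.
Qed.

Lemma sigma_generated_forall (B : edge n -> set R) :
  (forall e, measurable (B e)) ->
  sigma_generated p [set w | forall e, B e (p e w)].
Proof.
move=> mB; have -> : [set w | forall e, B e (p e w)] =
    \bigcap_(e in [set: edge n]) (p e @^-1` B e).
  by apply/seteqP; split => w /= H e; [move=> _; exact: H|exact: (H e I)].
apply: (@fin_bigcap_measurable _ (g_sigma_algebraType gen)) => // e _.
by apply: sub_sigma_algebra; exists e, (B e).
Qed.

End SigmaGenerated.

Section SystemLaw.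
Context d (T : measurableType d) (R : realType) (P : probability T R) (n : nat).
Variable S : graph_system P n.

Let p w e : R := edge_prob S e w.
Let s := retention S.

Definition configuration (w : T) : config n := ((K1 S w, K2 S w), pistar S w).

Lemma measurable_configuration x : measurable (configuration @^-1` [set x]).
Proof.
have -> : configuration @^-1` [set x] =
    K1 S @^-1` [set x.1.1] `&` K2 S @^-1` [set x.1.2] `&` pistar S @^-1` [set x.2].
  apply/seteqP; split => w /=; first by move=> <-.
  by case: x => -[a b] c /= [[<- <-] <-].
apply: measurableI; last exact: measurable_pistar.
by apply: measurableI; [exact: measurable_K1|exact: measurable_K2].
Qed.

Lemma edge_prob01 w e : 0 <= p w e <= 1. Proof. exact: edge_prob_itv. Qed.

Let sigma A := sigma_generated (fun e => edge_prob S e : T -> R) A.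

Let sigma_measurable A : sigma A -> measurable A.
Proof. by apply: sigma_generated_measurable => e; exact: measurable_funP. Qed.

Lemma measurable_edge_law (D : set T) g : measurable_fun D (fun w => edge_law (p w) g).
Proof.
apply: measurable_prod => e _; case: (e \in g).
  apply: (measurable_funS measurableT) => //; exact: measurable_funP.
apply: measurable_funB; first exact: measurable_cst.
apply: (measurable_funS measurableT) => //; exact: measurable_funP.
Qed.

Lemma edge_law_ge0 (q : edge n -> R) g : (forall e, 0 <= q e <= 1) -> 0 <= edge_law q g.
Proof.
move=> q01; apply: prodr_ge0 => e _; have /andP[q0 q1] := q01 e.
by case: (e \in g); rewrite ?subr_ge0.
Qed.

(* [thinning_law] quantifies over predicates [g] on edges; only those that are
   the membership predicate of a graph carry information. *)
Lemma thinning A (g k1 k2 : graph n) : sigma A ->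
  P (A `&` Gup S @^-1` [set g] `&` K1 S @^-1` [set k1] `&` K2 S @^-1` [set k2]) =
  (P (A `&` Gup S @^-1` [set g]) *
   (edge_law (fun e => s * (e \in g)%:R) k1 * edge_law (fun e =>
     s * (e \in g)%:R) k2)%:E)%E.
Proof.
move=> sA; have := @thinning_law _ _ _ _ _ S A (mem g) k1 k2 sA => /=.
set G1 := (X in A `&` X); have -> // : G1 = Gup S @^-1` [set g].
apply/seteqP; split => w; rewrite /G1 /=; last by move=> ->.
by move=> e; apply/finset.setP => f; rewrite -!topredE /= e.
Qed.

(** Summing over the values of [Gup] turns the two thinnings into [pair_law]. Since [A] ranges over
    the whole sigma-algebra of the edge probabilities, bounds on [pair_law] that hold pointwise on
    [A] can be integrated. *)
Lemma configuration_law A (x : config n) : sigma A ->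
  P (A `&` configuration @^-1` [set x]) =
  ((n`!%:R^-1)%:E * \int[P]_(w in A) (pair_law s (p w) x.1.1 x.1.2)%:E)%E.
Proof.
move=> sA; have mA := sigma_measurable sA.
have mB : measurable (A `&` configuration @^-1` [set x]).
  by apply: measurableI => //; exact: measurable_configuration.
have := measure_finite P (@measurable_Gup _ _ _ _ _ S) predT mB.
rewrite (_ : [set w | predT _] = setT) ?setIT; last by apply/seteqP; split.
move=> <-.
pose c (g : graph n) : R := edge_law (fun e => s * (e \in g)%:R) x.1.1 *
                edge_law (fun e => s * (e \in g)%:R) x.1.2.
have c0 g : 0 <= c g.
  apply: mulr_ge0; apply: edge_law_ge0 => e; have /andP[s0 s1] := retention_itv S;
  by case: (e \in g); rewrite ?mulr1 ?mulr0 ?lexx ?ler01 ?s0.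
have term g : P (A `&` configuration @^-1` [set x] `&` Gup S @^-1` [set g]) =
   ((n`!%:R^-1)%:E * \int[P]_(w in A) (edge_law (p w) g * c g)%:E)%E.
  have -> : A `&` configuration @^-1` [set x] `&` Gup S @^-1` [set g] =
     A `&` Gup S @^-1` [set g] `&` K1 S @^-1` [set x.1.1] `&` K2 S @^-1` [set x.1.2]
     `&` pistar S @^-1` [set x.2].
    apply/seteqP; split => w /=; first by case=> -[Aw <-] <-.
    by case: x {mB c c0} => -[a b] t /= [[[[Aw <-] <-] <-] <-].
  etransitivity; first exact: (@pistar_law _ _ _ _ _ S A g x.1.1 x.1.2 x.2 sA).
  rewrite muleC; congr (_ * _)%E.
  etransitivity; first exact: (thinning g x.1.1 x.1.2 sA).
  rewrite (Gup_law _ sA); under [RHS]eq_integral do rewrite EFinM.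
  rewrite ge0_integralZr //.
  - by apply/measurable_EFinP; exact: measurable_edge_law.
  - by move=> w _; rewrite lee_fin edge_law_ge0 // => e; exact: edge_prob01.
  - by rewrite lee_fin.
under eq_bigr do rewrite term.
rewrite -ge0_sume_distrr; last first.
  move=> g _; apply: integral_ge0 => w _; rewrite lee_fin mulr_ge0 //.
  by apply: edge_law_ge0 => e; exact: edge_prob01.
congr (_ * _)%E; rewrite -ge0_integral_sum //.
- apply: eq_integral => w _; rewrite -pair_lawE sumEFin; congr (_%:E).
- move=> g; apply/measurable_EFinP/measurable_funM => //; exact: measurable_edge_law.
- by move=> g w _; rewrite lee_fin mulr_ge0 ?edge_law_ge0 // => e; exact: edge_prob01.
Qed.

Let triple w : graph n * graph n * graph n := ((Gup S w, K1 S w), K2 S w).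

Let measurable_triple x : measurable (triple @^-1` [set x]).
Proof.
have -> : triple @^-1` [set x] =
    Gup S @^-1` [set x.1.1] `&` K1 S @^-1` [set x.1.2] `&` K2 S @^-1` [set x.2].
  apply/seteqP; split => w /=; first by move=> <-.
  by case: x => -[a b] c /= [[<- <-] <-].
apply: measurableI; last exact: measurable_K2.
by apply: measurableI; [exact: measurable_Gup|exact: measurable_K1].
Qed.

(** The record makes [K1] and [K2] subgraphs of [Gup] only almost surely: a thinning of [g] gives
    weight zero to every graph with an edge outside [g]. *)
Lemma observed_not_present A e : sigma A ->
  P (A `&` [set w | [|| e \in K1 S w | e \in K2 S w] && (e \notin Gup S w)]) = 0%E.
Proof.
move=> sA; have mA := sigma_measurable sA.
pose Q (x : graph n * graph n * graph n) := [|| e \in x.1.2 | e \in x.2] &&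
  (e \notin x.1.1).
have <- := measure_finite P measurable_triple Q mA.
apply: big1 => -[[g k1] k2] /andP[/= ek eg].
have -> : A `&` triple @^-1` [set (g, k1, k2)] =
  A `&` Gup S @^-1` [set g] `&` K1 S @^-1` [set k1] `&` K2 S @^-1` [set k2].
  apply/seteqP; split => w /=; first by case=> Aw [<- <- <-].
  by case=> -[[Aw <-] <-] <-.
etransitivity; first exact: (thinning g k1 k2 sA).
have thin0 (k : graph n) : e \in k ->
    edge_law (fun f => s * (f \in g)%:R) k = 0.
  by move=> ek'; rewrite /edge_law (bigD1 e) //= ek' (negPf eg) mulr0 mul0r.
by case/orP: ek => /thin0 ->; rewrite ?mulr0 ?mul0r mule0.
Qed.

Lemma sum_edge_law (q : edge n -> R) e : \sum_(g : graph n | e \in g) edge_law q g =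
  q e.
Proof.
(* Expanding this product gives one term for each graph; the zero in the factor of [e] kills the
   graphs that miss [e]. *)
transitivity (\prod_f (q f + (if f == e then 0 else 1 - q f))); last first.
  rewrite (bigD1 e) //= eqxx addr0 big1 ?mulr1 // => f /negPf ->.
  by rewrite addrC subrK.
rewrite bigA_distr [LHS]big_mkcond; apply: eq_bigr => g _; case: ifPn => eg.
  apply: eq_bigr => f _; case: ifPn => // fg; case: eqP => // fe.
  by rewrite fe eg in fg.
by rewrite (bigD1 e) //= (negPf eg) eqxx mul0r.
Qed.

Lemma observed_edge_le A e : sigma A ->
  (P (A `&` [set w | [|| e \in K1 S w | e \in K2 S w]]) <=
    \int[P]_(w in A) (p w e)%:E)%E.
Proof.
move=> sA; have mA := sigma_measurable sA.
have mG (Q : pred (graph n * graph n * graph n)) :=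
  measurable_finite measurable_triple Q.
pose N := A `&` [set w | [|| e \in K1 S w | e \in K2 S w] && (e \notin Gup S w)].
have mN : measurable N.
  apply: measurableI => //.
  exact: (mG (fun x => [|| e \in x.1.2 | e \in x.2] && (e \notin x.1.1))).
have mE : measurable (A `&` [set w | e \in Gup S w]).
  by apply: measurableI => //; exact: (mG (fun x => e \in x.1.1)).
apply: (@le_trans _ _ (P ((A `&` [set w | e \in Gup S w]) `|` N))).
  apply: le_measure; rewrite ?inE.
  - by apply: measurableI => //; exact: (mG (fun x => [|| e \in x.1.2 | e \in x.2])).
  - exact: measurableU.
  - move=> w [Aw /= ek]; have [eg|eg] := boolP (e \in Gup S w); first by left.
    by right; split => //=; rewrite ek eg.
have N0 : P N = 0%E := observed_not_present e sA.
apply: (@le_trans _ _ (P (A `&` [set w | e \in Gup S w]) + P N)%E).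
  exact: measureU2.
rewrite N0 adde0.
rewrite -(measure_finite P (@measurable_Gup _ _ _ _ _ S) (fun g => e \in g) mA).
under eq_bigr do rewrite (Gup_law _ sA).
rewrite big_mkcond /= le_eqVlt; apply/orP; left; apply/eqP.
transitivity (\sum_(g : graph n) \int[P]_(w in A) (if e \in g then edge_law (p w) g
  else 0)%:E)%E.
  apply: eq_bigr => g _; case: ifP => // _.
  by rewrite integral0.
rewrite -ge0_integral_sum //.
- apply: eq_integral => w _; rewrite -(sum_edge_law (p w)) sumEFin.
  by rewrite [in RHS]big_mkcond.
- move=> g; apply/measurable_EFinP; case: (e \in g); first exact: measurable_edge_law.
  exact: measurable_cst.
- move=> g w _; rewrite lee_fin; case: ifP => _ //.
  by apply: edge_law_ge0 => f; exact: edge_prob01.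
Qed.

End SystemLaw.

(** * Non-asymptotic bound on the correct matches in small components *)

Section HitsBound.
Context d (T : measurableType d) (R : realType) (P : probability T R) (n : nat).
Variable S : graph_system P n.
Variable pihat : graph n -> graph n -> 'S_n.
Variables (D k m : nat) (a M lam tau : R).

Let p w e : R := edge_prob S e w.
Let sigma A := sigma_generated (fun e => edge_prob S e : T -> R) A.
Let conf := configuration S.

Definition lower_event := [set w | forall e, a <= edge_prob S e w].

Definition heavy w : graph n := [set e | M / n%:R <= edge_prob S e w]%SET.

(** The part of [lower_event] on which the heavy graph is [h]. It belongs to the sigma-algebra of
    the edge probabilities, so that [configuration_law] applies to it. *)
Let cell (h : graph n) := [set w | forall e, (a <= p w e) && ((M / n%:R <=
  p w e) == (e \in h))].

Let sigma_sub (B : edge n -> set R) (A : set T) : (forall e, measurable (B e)) ->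
  A = [set w | forall e, B e (p w e)] -> sigma A.
Proof. by move=> mB ->; exact: sigma_generated_forall. Qed.

Let measurable_ge (c : R) : measurable [set z : R | c <= z].
Proof.
have -> : [set z : R | c <= z] = `[c, +oo[%classic.
  by apply/seteqP; split => z /=; rewrite in_itv /= andbT.
exact: measurable_itv.
Qed.

Let measurable_eq (c : R) (b : bool) : measurable [set z : R | (c <= z) == b].
Proof.
case: b.
  rewrite (_ : mkset _ = [set z : R | c <= z]); first exact: measurable_ge.
  by apply/seteqP; split => z /=; rewrite eqb_id.
rewrite (_ : mkset _ = ~` [set z : R | c <= z]).
  by apply: measurableC; exact: measurable_ge.
by apply/seteqP; split => z /=; rewrite eqbF_neg => /negP.
Qed.

Lemma sigma_lower_event : sigma lower_event.
Proof. by apply: (@sigma_sub (fun=> [set z | a <= z])) => // e;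
  exact: measurable_ge. Qed.

Let sigma_cell h : sigma (cell h).
Proof.
apply: (@sigma_sub (fun e => [set z | a <= z] `&` [set z | (M / n%:R <=
  z) == (e \in h)])).
  by move=> e; apply: measurableI; [exact: measurable_ge|exact: measurable_eq].
by apply/seteqP; split => w /= H e; [have /andP := H e|apply/andP; exact: H].
Qed.

Let sigma_edge e (c : R) (b : bool) : sigma [set w | (c <= p w e) == b].
Proof.
apply: (@sigma_sub (fun f => [set z | (f == e) ==> ((c <= z) == b)])).
  move=> f; case: (f == e) => /=; first exact: measurable_eq.
  rewrite (_ : mkset _ = setT) //; by apply/seteqP; split.
apply/seteqP; split => w /= H; first by move=> f; apply/implyP => /eqP ->.
by have := H e; rewrite eqxx.
Qed.

Let sigma_measurable A : sigma A -> measurable A.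
Proof. by apply: sigma_generated_measurable => e; exact: measurable_funP. Qed.

Let Z w := (heavy w, conf w).

Let cellE h : lower_event `&` heavy @^-1` [set h] = cell h.
Proof.
apply/seteqP; split => w /=.
  by case=> H <- e; rewrite H /= inE.
move=> H; split => [e|]; first by have /andP[] := H e.
by apply/finset.setP => e; have /andP[_ /eqP <-] := H e; rewrite inE.
Qed.

Let measurable_heavy h : measurable (heavy @^-1` [set h]).
Proof.
apply: sigma_measurable.
apply: (@sigma_sub (fun e => [set z | (M / n%:R <= z) == (e \in h)])).
  by move=> e; exact: measurable_eq.
apply/seteqP; split => w /=; first by move=> <- e; rewrite inE.
by move=> H; apply/finset.setP => e; rewrite inE (eqP (H e)).
Qed.

Let measurable_Z z : measurable (Z @^-1` [set z]).
Proof.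
have -> : Z @^-1` [set z] = heavy @^-1` [set z.1] `&` conf @^-1` [set z.2].
  apply/seteqP; split => w /=; first by move=> <-.
  by case: z => h x /= [<- <-].
by apply: measurableI; [exact: measurable_heavy|exact: measurable_configuration].
Qed.

Let lower_Z h x : lower_event `&` Z @^-1` [set (h, x)] = cell h `&` conf @^-1` [set x].
Proof.
rewrite -cellE; apply/seteqP; split => w /=; first by case=> ? [<- <-].
by case=> -[? <-] <-.
Qed.

Let q z : R := fine (P (lower_event `&` Z @^-1` [set z])).

Lemma measurable_lower_event : measurable lower_event.
Proof. exact: sigma_measurable sigma_lower_event. Qed.

Let mlower := measurable_lower_event.

Let qE z : (q z)%:E = P (lower_event `&` Z @^-1` [set z]).
Proof. by rewrite fineK // fin_num_measure //; apply: measurableI. Qed.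

Let q_ge0 z : 0 <= q z.
Proof. by rewrite fine_ge0. Qed.

Let sum_q (Q : pred (graph n * config n)) :
  (\sum_(z | Q z) q z)%:E = P (lower_event `&` [set w | Q (Z w)]).
Proof.
rewrite -(measure_finite P measurable_Z Q mlower) -sumEFin.
by apply: eq_bigr => z _; rewrite qE.
Qed.

Let sum_q_le1 : \sum_z q z <= 1.
Proof.
rewrite -lee_fin (sum_q predT); apply: probability_le1.
by apply: measurableI => //; exact: (measurable_finite measurable_Z predT).
Qed.

Hypothesis (n0 : (0 < n)%N) (a0 : 0 < a) (M0 : 0 < M) (Mn : 4 * M <= n%:R).
Hypothesis (lam1 : 1 <= lam) (Mlam : 2 * M <= lam * a * n%:R).

(** [pair_law_swap] holds at every point of the cell: a light edge has [p e < M / n <= 1 / 4], and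
    [2 * p e <= 2 * M / n <= lam * a <= lam * p f] for every [f]. *)
Let q_relocate (h : graph n) x (t : 'S_n) (V : {set 'I_n}) :
  graph_act t (meet x) = meet x -> (forall v, t v != v -> v \in V) ->
  {in incident x.1.1 V, forall e, e \notin h} ->
  q (h, x) <= lam ^+ #|incident x.1.1 V| * q (h, relocate t x).
Proof.
move=> tI tV dV; have lam0 : 0 <= lam by exact: le_trans lam1.
rewrite -lee_fin EFinM !qE !lower_Z !(configuration_law _ (sigma_cell h)).
rewrite muleCA lee_wpmul2l // ?lee_fin ?invr_ge0 //.
have mp (k1 k2 : graph n) : measurable_fun (cell h) (fun w =>
  pair_law (retention S) (p w) k1 k2).
  apply: measurable_prod => e _; rewrite /pair_weight.
  have mpe : measurable_fun (cell h) (fun w => p w e).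
    by apply: (measurable_funS measurableT) => //; exact: measurable_funP.
  apply: measurable_funD.
    by apply: measurable_funM => //; apply: measurable_funM.
  apply: measurable_funM => //; apply: measurable_funM => //.
  exact: measurable_funB.
have ge0 w (k1 k2 : graph n) : 0 <= pair_law (retention S) (p w) k1 k2.
  by apply: pair_law_ge0; [exact: retention_itv|move=> e; exact: edge_prob_itv].
rewrite -ge0_integralZl_EFin //; last 4 first.
- exact: sigma_measurable.
- by move=> w _; rewrite lee_fin; exact: ge0.
- by apply/measurable_EFinP; exact: mp.
- by rewrite exprn_ge0.
apply: ge0_le_integral => //.
- exact: sigma_measurable.
- by move=> w _; rewrite lee_fin; exact: ge0.
- by apply/measurable_EFinP; exact: mp.
- by apply: measurable_funeM; apply/measurable_EFinP; exact: mp.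
move=> w wh; rewrite -EFinM lee_fin.
have nR : 0 < n%:R :> R by rewrite ltr0n.
apply: pair_law_swap => //.
- exact: retention_itv.
- by move=> e; exact: edge_prob_itv.
- by move=> e; have /andP[ae _] := wh e; exact: lt_le_trans ae.
- move=> e eV; have eh := dV e eV.
  have /andP[_] := wh e; rewrite (negPf eh) eqbF_neg -ltNge => pe.
  split.
    by apply: ltW; apply: lt_le_trans pe _; rewrite ler_pdivrMr // ler_pdivlMl.
  move=> f; have /andP[af _] := wh f.
  apply: (@le_trans _ _ (lam * a)); last by rewrite ler_wpM2l.
  have : p w e * n%:R < M by rewrite -ltr_pdivlMr.
  move=> pen; rewrite -(ler_pM2r nR); apply: le_trans Mlam.
  by rewrite -mulrA ler_pM2l // ltW.
Qed.

Hypothesis heavy_mass :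
  (\sum_e \int[P]_(w in [set w | (M / n%:R <= edge_prob S e w)%R]) (edge_prob S e w)%:E
    <= tau%:E)%E.

Let observed (z : graph n * config n) e := (e \in z.2.1.1) || (e \in z.2.1.2).

Let sum_heavy_edges :
  \sum_z q z * #|(z.2.1.1 :|: z.2.1.2) :&: z.1|%:R <= tau.
Proof.
rewrite -lee_fin; apply: le_trans heavy_mass.
pose Q e (z : graph n * config n) := observed z e && (e \in z.1).
have -> : \sum_z q z * #|(z.2.1.1 :|: z.2.1.2) :&: z.1|%:R =
  \sum_e \sum_(z | Q e z) q z.
  rewrite (exchange_big_dep predT) //=; apply: eq_bigr => z _.
  rewrite mulr_natr -sumr_const; apply: eq_bigl => e.
  by rewrite !inE.
rewrite -sumEFin; apply: lee_sum => e _; rewrite sum_q.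
have mE := sigma_measurable (sigma_edge e (M / n%:R) true).
rewrite -(_ : [set w | (M / n%:R <= p w e) == true] = [set w | M / n%:R <=
  edge_prob S e w]); last first.
  by apply/seteqP; split => w /=; rewrite eqb_id.
apply: le_trans (observed_edge_le _ (sigma_edge e (M / n%:R) true)).
apply: le_measure; rewrite ?inE.
- by apply: measurableI => //; exact: (measurable_finite measurable_Z (Q e)).
- by apply: measurableI => //;
  exact: (measurable_finite measurable_Z (fun z => observed z e)).
- move=> w [_ /=]; rewrite /Q /observed /= inE => /andP[-> H]; split => //=.
  by apply/eqP.
Qed.

Let sum_light_edges :
  \sum_z q z * #|(z.2.1.1 :|: z.2.1.2) :\: z.1|%:R <= n%:R * M.
Proof.
pose Q e (z : graph n * config n) := observed z e && (e \notin z.1).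
have -> : \sum_z q z * #|(z.2.1.1 :|: z.2.1.2) :\: z.1|%:R =
  \sum_e \sum_(z | Q e z) q z.
  rewrite (exchange_big_dep predT) //=; apply: eq_bigr => z _.
  rewrite mulr_natr -sumr_const; apply: eq_bigl => e.
  by rewrite !inE andbC.
have nR : 0 < n%:R :> R by rewrite ltr0n.
apply: (@le_trans _ _ (\sum_(e : edge n) M / n%:R)); last first.
  rewrite sumr_const -[leLHS]mulr_natl.
  apply: (@le_trans _ _ ((n * n)%:R * (M / n%:R))).
    by rewrite ler_wpM2r ?ler_nat ?card_edge_le // divr_ge0 // ltW.
  by rewrite natrM -mulrA ler_pM2l // mulrCA divff ?mulr1 // gt_eqF.
apply: ler_sum => e _; rewrite -lee_fin sum_q.
have sL := sigma_edge e (M / n%:R) false; have mL := sigma_measurable sL.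
apply: (@le_trans _ _ (\int[P]_(w in [set w | (M / n%:R <=
  p w e)%R == false]) (p w e)%:E)%E).
  apply: le_trans (observed_edge_le _ sL).
  apply: le_measure; rewrite ?inE.
  - by apply: measurableI => //; exact: (measurable_finite measurable_Z (Q e)).
  - by apply: measurableI => //;
    exact: (measurable_finite measurable_Z (fun z => observed z e)).
  - move=> w [_ /=]; rewrite /Q /observed /= inE => /andP[-> H]; split => //=.
    by rewrite eqbF_neg.
apply: (@le_trans _ _ (\int[P]_(w in [set w | (M / n%:R <=
  p w e)%R == false]) (M / n%:R)%:E)%E).
  apply: ge0_le_integral => //.
  - by move=> w _; rewrite lee_fin; have /andP[] := edge_prob_itv S e w.
  - by apply/measurable_EFinP; apply: (measurable_funS measurableT) => //;
    exact: measurable_funP.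
  - by move=> w /=; rewrite eqbF_neg -ltNge lee_fin => /ltW.
rewrite integral_cst // -[leRHS]mule1 lee_wpmul2l ?probability_le1 //.
by rewrite lee_fin divr_ge0 // ltW.
Qed.

Definition small_hits w :=
  #|hits pihat (configuration S w) :&: small k (configuration S w)|.

(** Markov's inequality on [lower_event], applied to [card_hits_small]. The terms on the right come
    from popular hits, from vertices spoiled by bad ones, and from rare types; [n * M + tau] bounds
    the expected number of observed edges, and [tau] that of the heavy ones. *)
Lemma hits_bound (eta : R) :
  eta * n%:R * D%:R * m%:R *
    fine (P (lower_event `&` [set w | eta * n%:R <= (small_hits w)%:R])) <=
  D%:R * (lam ^+ (2 * k * D) * (n * #|{set walk_code D k}|)%:R) +
  m%:R * (k%:R * (4 * (n%:R * M + tau) + 2 * D%:R * tau) +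
   D%:R * (#|{: rooted_type D k}| * (m + k))%:R).
Proof.
set C := #|{set _}|; set Ty := #|{: rooted_type D k}|.
pose Nz (z : graph n * config n) := #|hits pihat z.2 :&: small k z.2|.
have -> : fine (P (lower_event `&` [set w | eta * n%:R <= (small_hits w)%:R])) =
    \sum_(z | eta * n%:R <= (Nz z)%:R) q z.
  by rewrite -[RHS]/(fine (_)%:E) sum_q.
apply: (@le_trans _ _ (\sum_z q z * (Nz z * D * m)%:R)).
  rewrite mulr_sumr big_mkcond; apply: ler_sum => z _; case: ifP => [zN|_].
    by rewrite mulrC ler_wpM2l // !natrM !ler_wpM2r.
  by rewrite mulr_ge0.
pose u1 (z : graph n * config n) := #|(z.2.1.1 :|: z.2.1.2) :&: z.1|.
pose u2 (z : graph n * config n) := #|(z.2.1.1 :|: z.2.1.2) :\: z.1|.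
pose hp (z : graph n * config n) := #|hits pihat z.2 :&: popular D k z.1 m z.2|.
have pointwise z : (Nz z * D * m <= D * (hp z * m) +
     m * (k * (4 * (u1 z + u2 z) + 2 * D * u1 z) + D * (Ty * (m + k))))%N.
  by rewrite cardsID; exact: card_hits_small.
apply: (@le_trans _ _ (\sum_z (D%:R * (q z * (hp z * m)%:R) +
   m%:R * (k%:R * (4 * (q z * (u1 z)%:R + q z * (u2 z)%:R) + 2 * D%:R * (q z * (u1
     z)%:R))
      + D%:R * (Ty * (m + k))%:R * q z)))).
  apply: ler_sum => z _.
  apply: (@le_trans _ _ (q z * (D * (hp z * m) +
     m * (k * (4 * (u1 z + u2 z) + 2 * D * u1 z) + D * (Ty * (m + k))))%:R)).
    by rewrite ler_wpM2l // ler_nat.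
  rewrite !(natrD, natrM); lra.
rewrite big_split /= -!mulr_sumr big_split /= -!mulr_sumr !big_split /= -!mulr_sumr
  big_split /=.
apply: lerD.
  rewrite ler_wpM2l //.
  rewrite (eq_bigr (fun z => q (z.1,
    z.2) * (#|hits pihat z.2 :&: popular D k z.1 m z.2| * m)%:R)); last by case.
  rewrite -(pair_bigA _ (fun h x => q (h,
    x) * (#|hits pihat x :&: popular D k h m x| * m)%:R)) /=.
  apply: (@le_trans _ _ (\sum_h lam ^+ (2 * k * D) * (n * C)%:R * \sum_x q (h, x))).
    apply: ler_sum => h _; apply: expected_popular_hits => //.
    by move=> x t V tI tV dV; exact: q_relocate.
  rewrite -mulr_sumr pair_bigA /= -[leRHS]mulr1 ler_wpM2l ?mulr_ge0 ?exprn_ge0 //.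
    exact: le_trans lam1.
  by apply: le_trans sum_q_le1; apply: ler_sum => -[].
rewrite ler_wpM2l //; apply: lerD.
  rewrite ler_wpM2l //; apply: lerD; rewrite ler_wpM2l //.
    by rewrite addrC lerD.
by rewrite -[leRHS]mulr1 ler_wpM2l.
Qed.

End HitsBound.

(** * Asymptotics *)

Section Growth.
Context {R : realType}.

Lemma near_ln_ge (b : R) : \forall n \near \oo, b <= ln n%:R.
Proof.
have := nbhs_infty_ger (expR b); apply: filterS => n /= bn.
rewrite -(expRK b) ler_ln ?posrE ?expR_gt0 //.
exact: lt_le_trans (expR_gt0 _) bn.
Qed.

(** With [x = ln n], the exponential series gives [n >= x ^ (q + 1) / (q + 1)!], which exceeds
    [c * x ^ q] once [x >= c * (q + 1)!]. *)
Lemma near_ln_pow (c : R) q : \forall n \near \oo, c * ln n%:R ^+ q <= n%:R.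
Proof.
have := near_ln_ge (Num.max 1 (c * q.+1`!%:R)).
apply: filterS => n; rewrite /= ge_max => /andP[l1 lc].
set x := ln _ in l1 lc *; have x0 : 0 <= x by exact: le_trans l1.
have n0 : 0 < n%:R :> R.
  rewrite ltr0n lt0n; apply/eqP => n0; move: l1; rewrite /x n0 ln0 //.
  by rewrite ler10.
have fact0 : 0 < q.+1`!%:R :> R by rewrite ltr0n fact_gt0.
rewrite -[leRHS]lnK ?posrE // -/x.
apply: le_trans (expR_ge1Dxn q x0).
apply: (@le_trans _ _ (x ^+ q.+1 / q.+1`!%:R)); last by rewrite lerDr.
by rewrite ler_pdivlMr // mulrAC exprS ler_wpM2r ?exprn_ge0.
Qed.

Lemma near_polylog (c M r : R) L : 0 <= c -> 0 <= M -> 0 <= r ->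
  \forall n \near \oo, c * Num.max 1 (2 * M * ln n%:R `^ r) ^+ L <= n%:R.
Proof.
move=> c0 M0 r0; pose N := Num.bound r.
have rN : r <= N%:R by apply/ltW; exact: Num.Theory.archi_boundP.
near=> n.
have l1 : 1 <= ln n%:R :> R by near: n; exact: near_ln_ge.
have l0 : 0 <= ln n%:R :> R by exact: le_trans l1.
apply: (@le_trans _ _ (c * (1 + 2 * M) ^+ L * ln n%:R ^+ (N * L))).
  rewrite -[leRHS]mulrA ler_wpM2l // exprM -exprMn lerXn2r ?nnegrE //.
  - by rewrite le_max ler01.
  - by rewrite mulr_ge0 ?exprn_ge0 // addr_ge0 // mulr_ge0.
  have lN : ln n%:R `^ r <= ln n%:R ^+ N :> R by rewrite -powR_mulrn // ler_powR.
  have lN1 : 1 <= ln n%:R ^+ N :> R by exact: exprn_ege1.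
  have lr0 : 0 <= ln n%:R `^ r :> R by exact: powR_ge0.
  rewrite ge_max; apply/andP; split; nra.
by near: n; exact: near_ln_pow.
Unshelve. all: by end_near. Qed.

End Growth.

Section HeavyMass.
Context {R : realType} {d : nat -> measure_display}.
Context {T : forall n, measurableType (d n)} {P : forall n, probability (T n) R}.
Variable sys : forall n, graph_system (P n) n.

(** [edge_tail] averages [n * p_e] over the edges; undoing both normalizations costs the factor
    [#|E| / n], at most [n]. *)
Lemma edge_tail_heavy_mass (M eta : R) n : (0 < n)%N -> 0 <= eta ->
  (edge_tail sys M n <= eta%:E)%E ->
  (\sum_e \int[P n]_(w in [set w | (M / n%:R <= edge_prob (sys n) e w)%R])
     (edge_prob (sys n) e w)%:E <= (eta * n%:R)%:E)%E.
Proof.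
move=> n0 eta0; rewrite /edge_tail; have nR : 0 < n%:R :> R by rewrite ltr0n.
set Y := (X in _ -> (X <= _)%E).
have mp e : measurable_fun [set: T n] (edge_prob (sys n) e) by exact: measurable_funP.
have -> : (\sum_(e : edge n) \int[P n]_(w in [set w |
      (M <= `|n%:R * edge_prob (sys n) e w|)%R])
     `|n%:R * edge_prob (sys n) e w|%:E = n%:R%:E * Y)%E.
  rewrite /Y ge0_sume_distrr; last first.
    move=> e _; apply: integral_ge0 => w _; rewrite lee_fin.
    by have /andP[] := edge_prob_itv (sys n) e w.
  apply: eq_bigr => e _.
  have pe0 w : 0 <= edge_prob (sys n) e w by have /andP[] := edge_prob_itv (sys n) e w.
  have -> : [set w | (M <= `|n%:R * edge_prob (sys n) e w|)%R] =
            [set w | (M / n%:R <= edge_prob (sys n) e w)%R].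
    by apply/seteqP; split => w /=; rewrite ler_pdivrMr // ger0_norm ?mulr_ge0 // mulrC.
  under eq_integral do rewrite ger0_norm ?mulr_ge0 // EFinM.
  rewrite ge0_integralZl_EFin //.
  - rewrite -[X in measurable X]setTI; apply: measurable_fun_le => //.
  - by move=> w _; rewrite lee_fin.
  - by apply/measurable_EFinP; exact: (measurable_funS measurableT).
have [E0|E0] := posnP #|{: edge n}|.
  move=> _; rewrite /Y big_pred0 ?lee_fin ?mulr_ge0 // => e.
  by have := card0_eq E0 e; rewrite !inE.
rewrite lee_pdivrMl ?ltr0n // => tailM.
rewrite -(@lee_pmul2l _ n%:R%:E) //.
apply: le_trans tailM _; rewrite -!EFinM lee_fin mulrCA mulrC ler_wpM2l //.
by rewrite -natrM ler_nat card_edge_le.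
Qed.

Lemma weakly_inhomogeneous_heavy_mass (eta : R) :
  weakly_inhomogeneous sys -> 0 < eta -> exists M : R, 0 < M /\
  forall n, (0 < n)%N ->
  (\sum_e \int[P n]_(w in [set w | (M / n%:R <= edge_prob (sys n) e w)%R])
     (edge_prob (sys n) e w)%:E <= (eta * n%:R)%:E)%E.
Proof.
move=> wi eta0.
have nb : nbhs (0%E : \bar R) [set y | (y < eta%:E)%E].
  apply: open_nbhs_nbhs; split; first exact: open_ereal_lt_ereal.
  by rewrite /= lte_fin.
have := wi _ nb => wi'.
have : \forall M \near +oo%R, (0 < M :> R) /\
   (ereal_sup [set edge_tail sys M n | n in [set n | (1 <= n)%N]] < eta%:E)%E.
  near=> M; split; near: M => //.
  exact: nbhs_pinfty_gt.
move=> /filter_ex[M [M0 supM]]; exists M; split => // n n0.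
apply: edge_tail_heavy_mass => //; first exact: ltW.
by apply/ltW; apply: le_lt_trans supM; apply: ereal_sup_ubound; exists n.
Unshelve. all: by end_near. Qed.

End HeavyMass.

(** Each of the four terms on the right is at most [n * D * m * b]; the 8 in [b] makes their sum
    [eta * n * D * m * (kappa / 2)]. *)
Lemma hits_arith (R : realType) (eta kappa n D m k M eta' Ty mk lamC p : R) :
  let b := kappa * eta / 8 in
  0 < eta -> 0 < n -> 0 < D -> 0 < m -> 0 <= k ->
  lamC <= b * m -> 4 * k * (M + eta') <= b * D -> 2 * k * eta' <= b ->
  Ty * mk <= b * n ->
  eta * n * D * m * p <= D * (lamC * n) +
    m * (k * (4 * (n * M + eta' * n) + 2 * D * (eta' * n)) + D * (Ty * mk)) ->
  p <= kappa / 2.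
Proof.
move=> b eta0 n0 D0 m0 k0 hC hD hk hT H.
have z0 : 0 < n * D * m by rewrite !mulr_gt0.
have h1 : D * (lamC * n) <= n * D * m * b.
  have -> : n * D * m * b = (D * n) * (b * m) by lra.
  have -> : D * (lamC * n) = (D * n) * lamC by lra.
  by rewrite ler_pM2l // mulr_gt0.
have h2 : m * (k * (4 * (n * M + eta' * n))) <= n * D * m * b.
  have -> : n * D * m * b = (m * n) * (b * D) by lra.
  have -> : m * (k * (4 * (n * M + eta' * n))) = (m * n) * (4 * k * (M + eta')) by lra.
  by rewrite ler_pM2l // mulr_gt0.
have h3 : m * (k * (2 * D * (eta' * n))) <= n * D * m * b.
  have -> : m * (k * (2 * D * (eta' * n))) = n * D * m * (2 * k * eta') by lra.
  by rewrite ler_pM2l.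
have h4 : m * (D * (Ty * mk)) <= n * D * m * b.
  have -> : n * D * m * b = (m * D) * (b * n) by lra.
  by rewrite mulrA ler_pM2l // mulr_gt0.
rewrite -(ler_pM2l (mulr_gt0 eta0 z0)).
have -> : eta * (n * D * m) * (kappa / 2) = 4 * (n * D * m * b) by rewrite /b; lra.
lra.
Qed.

Section Vanish.
Context {R : realType} {d : nat -> measure_display}.
Context {T : forall n, measurableType (d n)} {P : forall n, probability (T n) R}.
Variable sys : forall n, graph_system (P n) n.
Variables (r : R) (pihat : forall n, graph n -> graph n -> 'S_n).
Hypotheses (wi : weakly_inhomogeneous sys) (r0 : 0 <= r).
Let A n : set (T n) := lower_event (sys n) (1 / (n%:R * (ln n%:R) `^ r)).
Arguments A : clear implicits.
Hypothesis whpA : whp P A.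

Lemma measurable_event n (S : graph_system (P n) n) (Q : config n -> Prop) :
  measurable [set w | Q (configuration S w)].
Proof.
rewrite (_ : mkset _ = [set w | `[< Q (configuration S w) >]]).
  exact: (measurable_finite (@measurable_configuration _ _ _ _ _ S) (fun x =>
    `[< Q x >])).
by apply/seteqP; split => w /asboolP.
Qed.

Let measurable_A n : measurable (A n).
Proof.
exact: measurable_lower_event.
Qed.

Lemma small_hits_vanish k (eta kappa : R) : 0 < eta -> 0 < kappa ->
  \forall n \near \oo,
    (P n [set w | (eta * n%:R <= (small_hits (sys n) (@pihat n) k w)%:R)%R] <=
      kappa%:E)%E.
Proof.
move=> eta0 kappa0.
(* The constants are fixed in the order [eta'], [M], [D], [Ty] and [C], [delta], each from the
   preceding ones and none depending on [n]. Only [m], linear in [n], and [lam], a power of [ln n],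
   vary. *)
pose b := kappa * eta / 8.
have b0 : 0 < b by rewrite divr_gt0 // mulr_gt0.
pose eta' := b / (2 * k.+1%:R).
have eta'0 : 0 < eta' by rewrite divr_gt0 // mulr_gt0.
have [M [M0 massM]] := weakly_inhomogeneous_heavy_mass wi eta'0.
pose D := (Num.bound (4 * k%:R * (M + eta') / b)).+1.
pose Ty := #|{: rooted_type D k}|.
pose C := #|{set walk_code D k}|.
pose delta := b / (2 * Ty.+1%:R).
have delta0 : 0 < delta by rewrite divr_gt0 // mulr_gt0.
have hD : 4 * k%:R * (M + eta') <= b * D%:R.
  rewrite -ler_pdivrMl // mulrC; apply/ltW;
    apply: lt_trans (_ : (Num.bound (4 * k%:R * (M + eta') / b))%:R < _).
    by apply: Num.Theory.archi_boundP; rewrite divr_ge0 ?mulr_ge0 ?addr_ge0 // ltW.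
  by rewrite ltr_nat.
have hk : 2 * k%:R * eta' <= b.
  have -> : b = 2 * k.+1%:R * eta' by rewrite /eta' mulrCA divff ?mulr1 // mulf_neq0.
  by rewrite ler_pM2r // ler_pM2l // ler_nat.
have ncompl : \forall n \near \oo, (P n (~` A n) <= (kappa / 2)%:E)%E.
  have nb : nbhs (1%E : \bar R) [set y | ((1 - kappa / 2)%:E < y)%E].
    apply: open_nbhs_nbhs; split; first exact: open_ereal_gt_ereal.
    by rewrite /= lte_fin ltrBlDr ltrDl divr_gt0.
  have : \forall n \near \oo, ((1 - kappa / 2)%:E < P n (A n))%E := whpA nb.
  apply: filterS => n /= lt1.
  rewrite probability_setC; last by exact: measurable_A.
  move: lt1; rewrite -(@fineK _ (P n (A n))) ?fin_num_measure //.
  by rewrite lte_fin -EFinB lee_fin => ?; lra.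
near=> n.
have n0 : (0 < n)%N by near: n; exact: nbhs_infty_gt.
have nR : 0 < n%:R :> R by rewrite ltr0n.
pose m := Num.truncn (delta * n%:R).
have dn0 : 0 <= delta * n%:R by rewrite mulr_ge0 // ltW.
have /andP[m1 m2] := truncn_itv dn0; rewrite -/m -natr1 in m1 m2.
have l1 : 1 <= ln n%:R :> R by near: n; exact: near_ln_ge.
have l0 : 0 < ln n%:R :> R by exact: lt_le_trans l1.
have lr0 : 0 < ln n%:R `^ r :> R by exact: powR_gt0.
pose a := 1 / (n%:R * (ln n%:R) `^ r) : R.
have a0 : 0 < a by rewrite divr_gt0 // mulr_gt0.
pose lam := Num.max 1 (2 * M * ln n%:R `^ r) : R.
have lam1 : 1 <= lam by rewrite le_max lexx.
have Mlam : 2 * M <= lam * a * n%:R.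
  have -> : lam * a * n%:R = lam / ln n%:R `^ r.
    by rewrite /a mul1r invfM mulrA mulrAC -[lam * n%:R^-1 * _]mulrA mulVf ?mulr1 //
      gt_eqF.
  by rewrite ler_pdivlMr // le_max lexx orbT.
have Mn : 4 * M <= n%:R by near: n; exact: nbhs_infty_ger.
(* Once [delta * n >= 2], the integer part [m] is at least [delta * n / 2], which beats any power of
   the logarithm. *)
have hC : C%:R * lam ^+ (2 * k * D) <= b * m%:R.
  apply: (@le_trans _ _ (b * (delta * n%:R - 1))); last by rewrite ler_wpM2l ?ltW //;
    lra.
  have : 2 / (b * delta) * C%:R * lam ^+ (2 * k * D) <= n%:R.
    rewrite /lam; near: n; apply: near_polylog => //; last exact: ltW.
    by rewrite mulr_ge0 // divr_ge0 // mulr_ge0 // ltW.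
  have dn : 2 <= delta * n%:R.
    by rewrite -ler_pdivrMl //; near: n; exact: nbhs_infty_ger.
  rewrite -mulrA -ler_pdivlMl ?divr_gt0 ?mulr_gt0 // invf_div => X.
  apply: le_trans X _; rewrite -mulrA -mulrA ler_pM2l //; lra.
have hT : Ty%:R * (m + k)%:R <= b * n%:R.
  have h1 : Ty%:R * m%:R <= b / 2 * n%:R.
    apply: (@le_trans _ _ (Ty.+1%:R * (delta * n%:R))).
      by rewrite ler_pM // ler_nat.
    rewrite mulrA; have -> // : Ty.+1%:R * delta = b / 2.
    by rewrite /delta invfM mulrCA [Ty.+1%:R * _]mulrCA divff ?mulr1 // pnatr_eq0.
  have h2 : 2 * (Ty%:R * k%:R) <= b * n%:R.
    by rewrite -ler_pdivrMl //; near: n; exact: nbhs_infty_ger.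
  rewrite natrD mulrDr; lra.
have m0 : (0 < m)%N.
  have dn : 2 <= delta * n%:R.
    by rewrite -ler_pdivrMl //; near: n; exact: nbhs_infty_ger.
  rewrite -(ltr_nat R); lra.
have D0 : 0 < D%:R :> R by rewrite ltr0n.
have mR : 0 < m%:R :> R by rewrite ltr0n.
set E := [set w | _].
have mE : measurable E by exact: (measurable_event (sys n) (fun x => eta * n%:R <=
  (#|hits (@pihat n) x :&: small k x|)%:R)).
have mA := measurable_A n.
have bound : (P n (A n `&` E) <= (kappa / 2)%:E)%E.
  have mAE : measurable (A n `&` E) by exact: measurableI.
  rewrite -(@fineK _ (P n (A n `&` E))) ?fin_num_measure // lee_fin.
  have := hits_bound (@pihat n) D k m n0 a0 M0 Mn lam1 Mlam (massM n n0) eta.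
  rewrite -/(A n) -/E -/C -/Ty; set p := fine _ => H.
  have hC' : lam ^+ (2 * k * D) * C%:R <= b * m%:R by rewrite mulrC.
  apply: (hits_arith eta0 nR D0 mR (ler0n _ k) hC' hD hk hT).
  move: H; rewrite !natrM [lam ^+ _ * (_ * _)]mulrCA [n%:R * (lam ^+ _ * _)]mulrC.
  exact.
have compl : (P n (~` A n) <= (kappa / 2)%:E)%E.
  by near: n.
(* The other half of [kappa] covers the failure of the lower bound on the edge probabilities. *)
apply: (@le_trans _ _ (P n (A n `&` E `|` ~` A n))).
  apply: le_measure; rewrite ?inE //.
  - by apply: measurableU; [exact: measurableI|exact: measurableC].
  - by move=> w Ew; have [Aw|nAw] := pselect (A n w); [left|right].
apply: (@le_trans _ _ (P n (A n `&` E) + P n (~` A n))%E).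
  by apply: measureU2; [exact: measurableI|exact: measurableC].
by rewrite [X in X%:E]splitr EFinD leeD.
Unshelve. all: by end_near. Qed.

End Vanish.

(** * Limits superior and limits in probability *)

Section LimSup.
Context {R : realType}.
Implicit Types u v : nat -> \bar R.
Local Open Scope ereal_scope.

Lemma limn_esupE u : limn_esup u = ereal_inf (range (esups u)).
Proof. by rewrite limn_esup_lim; apply/cvg_lim => //; exact: cvg_esups_inf. Qed.

Lemma le_limn_esup u v : (forall n, u n <= v n) -> limn_esup u <= limn_esup v.
Proof.
move=> uv; rewrite !limn_esupE; apply: le_ereal_inf_tmp => _ [n _ <-].
apply: (@le_trans _ _ (esups u n)); first by apply: ereal_inf_lbound; exists n.
apply: ge_ereal_sup => _ [k /= nk <-]; apply: le_trans (uv k) _.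
by apply: ereal_sup_ubound; exists k.
Qed.

Lemma limn_esup_lt u x : limn_esup u < x -> \forall n \near \oo, u n <= x.
Proof.
rewrite limn_esupE => /ereal_inf_lt[_ [N _ <-] uN].
exists N => // n /= Nn; apply: le_trans (ltW uN).
by apply: ereal_sup_ubound; exists n.
Qed.

Lemma limn_esup_cst (x : \bar R) : limn_esup (fun _ : nat => x) = x.
Proof.
rewrite limn_esupE; apply/le_anti/andP; split.
  apply: (@le_trans _ _ (esups (fun=> x) 0%N)); first by apply: ereal_inf_lbound;
    exists 0%N.
  by apply: ge_ereal_sup => _ [k _ <-].
apply: le_ereal_inf_tmp => _ [n _ <-]; apply: ereal_sup_ubound.
by exists n => //=.
Qed.

Lemma near_le_cvg0 u : (forall n, 0 <= u n) ->
  (forall e : R, (0 < e)%R -> \forall n \near \oo, u n <= e%:E) -> u @ \oo --> 0.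
Proof.
move=> u0 ue; apply: limn_esup_le_cvg => //.
apply/lee_addgt0Pr => e e0; rewrite add0e limn_esupE.
have [N _ uN] := ue e e0.
apply: (@le_trans _ _ (esups u N)); first by apply: ereal_inf_lbound; exists N.
by apply: ge_ereal_sup => _ [n /= Nn <-]; exact: uN.
Qed.

End LimSup.

Section Pliminf.
Context {R : realType} {d : nat -> measure_display}.
Context {T : forall n, measurableType (d n)} (P : forall n, probability (T n) R).
Implicit Types X Y : forall n, T n -> R.

(** If these probabilities had a positive limit superior, [- y] would enter the supremum defining
    [plimsup] of [- X], forcing [pliminf] of [X] to be at most [y]. *)
Lemma pliminf_lt_near X (y kappa : R) :
  (y%:E < pliminf P X)%E -> 0 < kappa ->
  \forall n \near \oo, (P n [set w | (X n w <= y)%R] <= kappa%:E)%E.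
Proof.
move=> yX k0.
suff : \forall n \near \oo, (P n [set w | (- y <= - X n w)%R] <= kappa%:E)%E.
  apply: filterS => n; rewrite (_ : [set w | (- y <= - X n w)%R] = [set w | (X n w <=
    y)%R]) //.
  by apply/seteqP; split => w /=; rewrite lerN2.
apply: limn_esup_lt; rewrite (le_lt_trans _ (_ : 0 < kappa%:E)%E) // ?lte_fin //.
rewrite leNgt; apply/negP => pos; move: yX; apply/negP; rewrite -leNgt /pliminf.
rewrite leeNl -EFinN; apply: ereal_sup_ubound.
by exists (- y).
Qed.

Lemma pliminf_ge0_le1 X : (forall n w, 0 <= X n w <= 1) -> (0 <= pliminf P X <= 1)%E.
Proof.
move=> X01; apply/andP; split.
  rewrite leeNr oppe0; apply: ge_ereal_sup => _ [z /= pos <-]; rewrite lee_fin leNgt.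
  apply/negP => z0; move: pos; rewrite (_ : (fun n => _) = fun=> 0%E).
    by rewrite limn_esup_cst ltxx.
  apply/funext => n; rewrite (_ : mkset _ = set0) ?measure0 //.
  apply/seteqP; split => w //= zX; have /andP[X0 _] := X01 n w.
  by move: zX; rewrite leNgt => /negP; apply; apply: le_lt_trans z0; rewrite oppr_le0.
rewrite leeNl; apply: ereal_sup_ubound; exists (-1) => //=.
rewrite (_ : (fun n => _) = fun=> 1%E); first by rewrite limn_esup_cst lte01.
apply/funext => n; rewrite (_ : mkset _ = setT) ?probability_setT //.
by apply/seteqP; split => w //= _; rewrite lerN2; have /andP[] := X01 n w.
Qed.

Lemma le_pliminf X Y : (forall n w, X n w <= Y n w) ->
  (forall n x, measurable [set w | (x <= - X n w)%R]) ->
  (forall n x, measurable [set w | (x <= - Y n w)%R]) ->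
  (pliminf P X <= pliminf P Y)%E.
Proof.
move=> XY mX mY; rewrite leeN2; apply: ereal_sup_le => _ [x /= pos <-].
exists x => //=; apply: lt_le_trans pos _; apply: le_limn_esup => n.
apply: le_measure; rewrite ?inE //.
by move=> w /= /le_trans; apply; rewrite lerN2.
Qed.

End Pliminf.

(** * From hits to errors of the estimator *)

Section Errors.
Context {R : realType} {d : measure_display} {T : measurableType d}.
Context {P : probability T R} {n : nat}.
Variables (S : graph_system P n) (pihat : graph n -> graph n -> 'S_n).

Definition error_count (x : config n) :=
  #|[set v | pihat (graph_act x.2^-1%g x.1.1) x.1.2 v != x.2 v]%SET|.

(** The planted matching maps the correctly matched vertices bijectively onto the hits. *)
Lemma card_errors_hits x : (error_count x + #|hits pihat x| = n)%N.
Proof.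
rewrite /error_count.
pose E := [set v | pihat (graph_act x.2^-1%g x.1.1) x.1.2 v != x.2 v]%SET.
have -> : hits pihat x = [set x.2 v | v in (~: E)]%SET.
  apply/finset.setP => u; apply/idP/imsetP => [|[v vE ->]].
    rewrite inE => /eqP e; exists (x.2^-1%g u); last by rewrite permKV.
    by rewrite !inE negbK -e permKV e permKV.
  move: vE; rewrite !inE negbK => /eqP e.
  by rewrite permK -e permK.
rewrite card_imset; last exact: perm_inj.
by rewrite -/E cardsC card_ord.
Qed.

Lemma true_meetE w : true_meet S w = meet (configuration S w).
Proof.
rewrite /true_meet /graph_meet /Gobs /meet /=.
by rewrite -{1}[pistar S w]invgK graph_actK.
Qed.

End Errors.

(** * The sparse fraction and the final estimate *)

Section Main.
Context {R : realType} {d : nat -> measure_display}.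
Context {T : forall n, measurableType (d n)} {P : forall n, probability (T n) R}.
Variable sys : forall n, graph_system (P n) n.

Let sparse (eps : R) n (w : T n) : R := #|V_le sys (1 - eps) w|%:R / n%:R.

Lemma measurable_sparse (eps : R) n (Q : R -> Prop) :
  measurable [set w | Q (@sparse eps n w)].
Proof.
pose F (x : config n) : R :=
  #|[set v | balanced_load (meet x) v <= 1 - eps :> R]%SET|%:R / n%:R.
have -> : [set w | Q (@sparse eps n w)] = [set w | Q (F (configuration (sys n) w))].
  by apply/seteqP; split => w /=; rewrite /sparse /V_le true_meetE.
exact: (measurable_event (sys n) (fun x => Q (F x))).
Qed.

(** The sublevel sets grow as [eps] decreases, so the limit at 0 is a supremum. Any number below
    [x_sparse] is therefore exceeded by [pliminf] at a single fixed [eps], hence with a single bound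
    on the component size. *)
Lemma x_sparseE : x_sparse sys =
  ereal_sup ((fun eps => pliminf P (@sparse eps)) @` `]0, 1[%classic).
Proof.
rewrite /x_sparse; apply/cvg_lim => //.
apply: (@nonincreasing_at_right_cvge R _ 0 (BLeft 1)); first by rewrite bnd_simp ltr01.
move=> e1 e2 _ _ e12; apply: le_pliminf => [n w|n x|n x].
- rewrite /sparse ler_wpM2r ?invr_ge0 // ler_nat;
  apply/subset_leq_card/fintype.subsetP => v.
  by rewrite !inE => /le_trans; apply; rewrite lerB.
- exact: (measurable_sparse e2 n (fun z => x <= - z)).
- exact: (measurable_sparse e1 n (fun z => x <= - z)).
Qed.

Lemma sparse01 eps n w : 0 <= @sparse eps n w <= 1.
Proof.
rewrite /sparse divr_ge0 //=; have [n0|n0] := posnP n.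
  have -> : n%:R = 0 :> R by rewrite n0.
  by rewrite invr0 mulr0 ler01.
rewrite ler_pdivrMr ?ltr0n // mul1r ler_nat.
by apply: leq_trans (max_card _) _; rewrite card_ord.
Qed.

Lemma x_sparse_ge0_le1 : (0 <= x_sparse sys <= 1)%E.
Proof.
rewrite x_sparseE; have f01 eps := pliminf_ge0_le1 P (@sparse01 eps).
apply/andP; split.
  have /andP[h _] := f01 (1 / 2); apply: le_trans h _.
  apply: ereal_sup_ubound; exists (1 / 2) => //=.
  by rewrite in_itv /=; apply/andP; split; lra.
by apply: ge_ereal_sup => _ [e _ <-]; have /andP[] := f01 e.
Qed.

Lemma card_V_le (pihat : forall n, graph n -> graph n -> 'S_n) (eps : R) k n w :
  0 < eps -> 1 <= k%:R * eps ->
  (#|V_le sys (1 - eps) w| <=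
   small_hits (sys n) (@pihat n) k w + error_count (@pihat n) (configuration (sys n)
     w))%N.
Proof.
move=> e0 ke; set x := configuration _ _.
have sub : V_le sys (1 - eps) w \subset small k x.
  apply/fintype.subsetP => v; rewrite !inE true_meetE => lv.
  have := balanced_load_component e0 lv; rewrite -(ler_nat R) => le1.
  by rewrite -(ler_pM2r e0); exact: le_trans le1 ke.
have split : (#|V_le sys (1 - eps) w| <=
  #|hits (@pihat n) x :&: small k x| + #|~: hits (@pihat n) x|)%N.
  apply: leq_trans (leq_card_setU _ _); apply/subset_leq_card/fintype.subsetP => v vV.
  by rewrite finset.in_setU finset.in_setI finset.in_setC (fintype.subsetP sub _ vV)
    andbT orbN.
apply: leq_trans split _; rewrite leq_add2l.
have := card_errors_hits (@pihat n) x; have := cardsC (hits (@pihat n) x).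
rewrite card_ord; lia.
Qed.

End Main.

Theorem theorem3 (R : realType) (d : nat -> measure_display)
    (T : forall n, measurableType (d n)) (P : forall n, probability (T n) R)
    (sys : forall n, graph_system (P n) n)
    (r : R) (pihat : forall n, graph n -> graph n -> 'S_n) :
  weakly_inhomogeneous sys ->
  0 <= r ->
  whp P (fun n => [set w | forall e : edge n,
    1 / (n%:R * (ln n%:R) `^ r) <= edge_prob (sys n) e w]) ->
  exists X : forall n, T n -> R,
    littleo_prob P X (fun n _ => n%:R) /\
    forall n (w : T n),
      (x_sparse sys * (n%:R - X n w)%:E <=
       (#|[set v : 'I_n |
          pihat n (Gobs (sys n) w) (Hobs (sys n) w) v != pistar (sys n) w v]%SET|%:R)%:E)%E.
Proof.
move=> wi r0 whpA.
have /andP[x0 x1] := x_sparse_ge0_le1 sys.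
have xfin : x_sparse sys \is a fin_num.
  by rewrite ge0_fin_numE // (le_lt_trans x1) // ltry.
set x := fine (x_sparse sys); have xE : x_sparse sys = x%:E by rewrite fineK.
have xge0 : 0 <= x by rewrite fine_ge0.
pose err n (w : T n) : R := (error_count (@pihat n) (configuration (sys n) w))%:R.
(* For positive [x] and [n], the least nonnegative [c] with [x * (n - c * n) <= err]. For [x = 0]
   the bound is trivial and [c] is taken to be 0. *)
pose c n (w : T n) : R := if x == 0 then 0 else Num.max 0 (1 - err n w / (x * n%:R)).
have mc n : measurable_fun [set: T n] (c n).
  move=> _ B mB; rewrite setTI.
  exact: (measurable_event (sys n) (fun y => B (if x == 0 then 0 else
    Num.max 0 (1 - (error_count (@pihat n) y)%:R / (x * n%:R))))).
pose C n : {RV (P n) >-> R} := mfun_Sub (mem_set (mc n)).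
exists (fun n w => c n w * n%:R); split.
  exists C; split => [n w //|eps eps0].
  apply: near_le_cvg0 => [n|kappa kappa0]; first exact: measure_ge0.
  have [x00|xn0] := eqVneq x 0.
    near=> n; rewrite (_ : mkset _ = set0) ?measure0 ?lee_fin ?ltW //.
    apply/seteqP; split => w //=; rewrite /c x00 eqxx normr0.
    by rewrite leNgt eps0.
  have xpos : 0 < x by rewrite lt0r xn0.
  (* Half of [eps] is spent on approximating the supremum by one level [e]; the other half is left
     for the hits in small components. *)
  have : (((x * (1 - eps / 2))%:E < x_sparse sys)%E).
    by rewrite xE lte_fin gtr_pMr // ltrBlDr ltrDl divr_gt0.
  rewrite x_sparseE => /ereal_sup_gt[_ [e /= e01 <-] ye].
  have /andP[e0 _] : 0 < e < 1 by move: e01; rewrite in_itv.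
  pose k := Num.bound e^-1.
  have ke : 1 <= k%:R * e.
    rewrite -ler_pdivrMr // mul1r; apply/ltW/Num.Theory.archi_boundP.
    by rewrite invr_ge0 ltW.
  have eta0 : 0 < x * eps / 2 by rewrite divr_gt0 // mulr_gt0.
  have kap2 : 0 < kappa / 2 by rewrite divr_gt0.
  have n1 := pliminf_lt_near ye kap2.
  have n2 := small_hits_vanish pihat wi r0 whpA k eta0 kap2.
  near=> n.
  have nR : 0 < n%:R :> R by rewrite ltr0n; near: n; exact: nbhs_infty_gt.
  have xn : 0 < x * n%:R by rewrite mulr_gt0.
  (* If [c >= eps], there are at most [x * (1 - eps) * n] errors. Then either the sublevel set is
     too small, which is [E1], or at least [x * eps / 2 * n] vertices of small components are hits,
     which is [E2]. *)
  pose E1 := [set w : T n | (#|V_le sys (1 - e) w|%:R / n%:R <= x * (1 - eps / 2))%R].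
  pose E2 := [set w : T n | (x * eps / 2 * n%:R <=
    (small_hits (sys n) (@pihat n) k w)%:R)%R].
  have m1 : measurable E1 := measurable_sparse sys e n (fun z => z <=
    x * (1 - eps / 2)).
  have m2 : measurable E2.
    exact: (measurable_event (sys n) (fun y =>
      x * eps / 2 * n%:R <= (#|hits (@pihat n) y :&: small k y|)%:R)).
  apply: (@le_trans _ _ (P n (E1 `|` E2))).
    apply: le_measure; rewrite ?inE; last first.
    - move=> w /=; rewrite /c (negPf xn0) ger0_norm; last by rewrite le_max lexx.
      rewrite le_max leNgt eps0 /=.
      rewrite lerBrDr -lerBrDl ler_pdivrMr // => errw.
      have := card_V_le sys pihat w e0 ke;
        rewrite -(ler_nat R) natrD -/(err n w) => Vle.
      have [wE1|/negP] := boolP (#|V_le sys (1 - e) w|%:R / n%:R <= x * (1 - eps / 2)).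
        by left.
      move=> /negP; rewrite -ltNge ltr_pdivlMr // => gtV; right; rewrite /E2 /=; lra.
    - exact: measurableU.
    - exact: (measurable_event (sys n) (fun y => eps <= `|if x == 0 then 0 else
        Num.max 0 (1 - (error_count (@pihat n) y)%:R / (x * n%:R))|)).
  apply: le_trans (measureU2 _ m1 m2) _.
  rewrite [X in X%:E]splitr EFinD; apply: leeD.
    by rewrite /E1; near: n; exact: n1.
  by rewrite /E2; near: n; exact: n2.
move=> n w; rewrite xE -EFinM lee_fin -/(error_count (@pihat n) (configuration (sys
  n) w)) -/(err n w).
rewrite /c; case: eqVneq => [->|xn0]; first by rewrite mul0r.
have [n0|n0] := posnP n.
  have -> : n%:R = 0 :> R by rewrite n0.
  by rewrite !(mulr0, subr0) ler0n.
have xn : 0 < x * n%:R by rewrite mulr_gt0 ?ltr0n // lt0r xn0.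
set mx := Num.max _ _; have -> : x * (n%:R - mx * n%:R) = (1 - mx) * (x * n%:R) by lra.
rewrite -ler_pdivlMr // lerBlDr.
by rewrite -lerBlDl le_max lexx orbT.
Unshelve. all: by end_near. Qed.
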